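(* Let $N^n$ be an affine real manifold of dimension $n$, $2\leqslant n<\infty$. There exists a polydifferential operator $$\Diamond\in \mathrm{PolyDiff}\,\bigl(\Gamma(\textstyle\bigwedge^{2}TN^{n})\times \Gamma(\bigwedge^{3}TN^{n}) \to \Gamma(\bigwedge^{3}TN^{n}) \bigr)$$ which solves the factorization problem $$[\![\mathcal{P},\mathcal{Q}_{1:6}(\mathcal{P})]\!](f,g,h)=\Diamond\bigl(\mathcal{P},\mathrm{Jac}(\mathcal{P})(\cdot,\cdot,\cdot)\bigr)(f,g,h)$$ for all bi-vector fields $\mathcal{P}$ on $N^n$ and all (local) smooth functions $f,g,h$. Such an operator is realised by Leibniz graphs, namely by the linear combination $\Diamond=\sum c\cdot L$ of the following 27 Leibniz graphs $L$ (each written as an encoding, followed by its coefficient $c$; the encoding is explained in the context): $$\begin{array}{lll} (4J\,|\,5J\,|\,3J\,|\,0\,1\,2):-1; & (04\,|\,15\,|\,23\,|\,3\,4\,5):-3; & (04\,|\,25\,|\,13\,|\,3\,4\,5):+3;\\ (04\,|\,12\,|\,34\,|\,3\,4\,5):-3; & (01\,|\,23\,|\,34\,|\,3\,4\,5):-3; & (02\,|\,13\,|\,34\,|\,3\,4\,5):+3;\\ (45\,|\,1J\,|\,4J\,|\,0\,2\,3):-3; & (45\,|\,0J\,|\,4J\,|\,1\,2\,3):+3; & (5J\,|\,35\,|\,2J\,|\,0\,1\,4):-3;\\ (14\,|\,5J\,|\,3J\,|\,0\,2\,3):+3; & (04\,|\,5J\,|\,3J\,|\,1\,2\,3):-3;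 & (5J\,|\,23\,|\,4J\,|\,0\,1\,4):-3;\\ (12\,|\,35\,|\,3J\,|\,0\,3\,4):+3; & (02\,|\,35\,|\,3J\,|\,1\,3\,4):-3; & (4J\,|\,01\,|\,34\,|\,2\,4\,5):-3;\\ (15\,|\,35\,|\,2J\,|\,0\,3\,4):-3; & (15\,|\,35\,|\,0J\,|\,2\,3\,4):+3; & (05\,|\,35\,|\,2J\,|\,1\,3\,4):+3;\\ (25\,|\,35\,|\,1J\,|\,0\,3\,4):+3; & (25\,|\,35\,|\,0J\,|\,1\,3\,4):-3; & (05\,|\,35\,|\,1J\,|\,2\,3\,4):-3;\\ (14\,|\,25\,|\,3J\,|\,0\,3\,4):-3; & (15\,|\,23\,|\,4J\,|\,0\,3\,4):-3; & (04\,|\,25\,|\,3J\,|\,1\,3\,4):+3;\\ (05\,|\,23\,|\,4J\,|\,1\,3\,4):+3; & (4J\,|\,05\,|\,13\,|\,2\,4\,5):-3; & (4J\,|\,15\,|\,03\,|\,2\,4\,5):+3. \end{array}$$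
   Context: An affine real manifold $N^n$ is a smooth real manifold with an atlas whose coordinate changes are affine; all coordinate formulas below are in charts $(x^1,\dots,x^n)$ of that atlas, $\partial_i=\partial/\partial x^i$, and repeated indices are summed from $1$ to $n$. Bi-vectors. A bi-vector is $\mathcal{P}=\mathcal{P}^{ij}\,\partial_i\wedge\partial_j$ with $\mathcal{P}^{ij}=-\mathcal{P}^{ji}$, where $(\partial_i\wedge\partial_j)(f,g)=\partial_i f\,\partial_j g-\partial_j f\,\partial_i g$, so that $\mathcal{P}(f,g)=2\mathcal{P}^{ij}\partial_i f\,\partial_j g$. Schouten bracket. For two bi-vectors $A,B$, the Schouten bracket is the tri-vector $$[\![A,B]\!](f,g,h)=\sum_{\text{cyclic } (f,g,h)}\bigl(A(B(f,g),h)+B(A(f,g),h)\bigr).$$ Jacobiator. $\mathrm{Jac}(\mathcal{P})(f,g,h)=\mathrm{Jac}^{abc}\,\partial_a f\,\partial_b g\,\partial_c h$ is the tri-vector with totally antisymmetric coefficients $$\mathrm{Jac}^{abc}=\partial_s\mathcal{P}^{ab}\,\mathcal{P}^{sc}+\partial_s\mathcal{P}^{bc}\,\mathcal{P}^{sa}+\partial_s\mathcal{P}^{ca}\,\mathcal{P}^{sb}.$$ It equals $[\![\mathcal{P},\mathcal{P}]\!]$ up to a nonzero constant, and $\mathcal{P}$ is Poisson iff it vanishes. The Kontsevich tetrahedral flow. $\mathcal{Q}_{1:6}(\mathcal{P})=\tfrac14\Gamma_1(\mathcal{P})+\tfrac32\Gamma_2(\mathcal{P})$, where $$\Gamma_1(\mathcal{P})=\bigl(\partial_k\partial_\ell\partial_m\mathcal{P}^{ij}\;\partial_{\ell'}\mathcal{P}^{kk'}\;\partial_{m'}\mathcal{P}^{\ell\ell'}\;\partial_{k'}\mathcal{P}^{mm'}\bigr)\,\partial_i\wedge\partial_j,$$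 $$\Gamma_2(\mathcal{P})=\bigl(\partial_k\partial_\ell\mathcal{P}^{ij}\;\partial_{k'}\partial_{\ell'}\mathcal{P}^{km}\;\partial_{m'}\mathcal{P}^{k'\ell}\;\partial_{j}\mathcal{P}^{m'\ell'}\bigr)\,\partial_i\wedge\partial_m.$$ Leibniz graphs and their encoding. The graphs used here have three sinks $0,1,2$ (containing $f,g,h$ respectively), three internal vertices $3,4,5$, each containing a copy of $\mathcal{P}$ and being the source of an ordered pair of arrows, and one vertex $J$ (the Jacobiator vertex), which is the source of an ordered triple of arrows. The encoding $(t_3t_3'\,|\,t_4t_4'\,|\,t_5t_5'\,|\,u\,v\,w)$ means that for $k=3,4,5$ the first (left) arrow from vertex $k$ goes to the vertex $t_k$ and the second (right) arrow goes to $t_k'$, and that the first, second and third arrows from $J$ go to $u,v,w$. For a tri-vector $T$ with $T(f,g,h)=T^{abc}\partial_a f\,\partial_b g\,\partial_c h$ ($T^{abc}$ totally antisymmetric), the operator encoded by the graph sends $(\mathcal{P},T)$ to the following tri-differential operator on $(f,g,h)$: attach a summation index to each of the nine arrows; take the product of the contents of all the vertices, the content of vertex $k\in\{3,4,5\}$ being $\mathcal{P}^{i_kj_k}$ (with $i_k$ and $j_k$ the indices of its first and second outgoing arrows), the content of $J$ being $T^{abc}$ (with $a,b,c$ the indices of its outgoing arrows in order), and the contents of $0,1,2$ being $f,g,h$; apply to the content of each vertex the derivatives $\partial_i$ for all the indices $i$ of the arrows coming into it; and sum over all indices. For $T=\mathrm{Jac}(\mathcal{P})$ the derivatives falling on $J$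 thus act by the Leibniz rule on both copies of $\mathcal{P}$ in the coefficient $\mathrm{Jac}^{abc}$. *)

(* Defs.v *)
From HB Require Import structures.
From mathcomp Require Import all_boot all_order all_algebra.
From mathcomp Require Import all_classical all_reals all_analysis.
Import Order.TTheory GRing.Theory Num.Theory.
Import numFieldNormedType.Exports.

Set Implicit Arguments.
Unset Strict Implicit.
Unset Printing Implicit Defensive.

Local Open Scope classical_set_scope.
Local Open Scope ring_scope.

Section coordinate_calculus.
Context {R : realType} {n : nat}.
Implicit Types (f : 'rV[R]_n -> R) (V : set 'rV[R]_n).

Definition partial (i : 'I_n) f : 'rV[R]_n -> R :=
  fun y => 'D_(delta_mx 0 i) f y.

Definition partials (s : seq 'I_n) f : 'rV[R]_n -> R := foldr partial f s.

(* For open V this is the usual notion of a C^oo function on V: all iterated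
   partial derivatives exist and are continuous on V. *)
Definition smooth_on V f : Prop :=
  forall (s : seq 'I_n) (y : 'rV[R]_n), V y ->
    {for y, continuous (partials s f)} /\
    forall i : 'I_n, derivable (partials s f) y (delta_mx 0 i).

End coordinate_calculus.

(* The field [affm_affine] says that coordinate changes are locally affine, i.e.
   affine on each connected component of their domain.  The values of
   [chart_map a] outside [chart_dom a], and those of [chart_inv a] outside the
   image of [chart_dom a], are irrelevant. *)
Record affine_manifold (R : realType) (n : nat) := AffineManifold {
  affm_space :> topologicalType ;
  chart : Type ;
  chart_dom : chart -> set affm_space ;
  chart_map : chart -> affm_space -> 'rV[R]_n ;
  chart_inv : chart -> 'rV[R]_n -> affm_space ;
  affm_hausdorff : hausdorff_space affm_space ;
  affm_second_countable : @second_countable affm_space ;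
  affm_cover : forall x : affm_space, exists a, chart_dom a x ;
  affm_open_dom : forall a, open (chart_dom a) ;
  affm_open_img : forall a, open (chart_map a @` chart_dom a) ;
  affm_mapK : forall a x, chart_dom a x -> chart_inv a (chart_map a x) = x ;
  affm_map_cont : forall a x, chart_dom a x ->
    {for x, continuous (chart_map a)} ;
  affm_inv_cont : forall a y, (chart_map a @` chart_dom a) y ->
    {for y, continuous (chart_inv a)} ;
  affm_affine : forall a b x, chart_dom a x -> chart_dom b x ->
    exists (A : 'M[R]_n) (v : 'rV[R]_n),
      \forall z \near x, chart_map b z = chart_map a z *m A + v
}.

Section fields.
Context {R : realType} {n : nat}.
Variable N : affine_manifold R n.

Definition chart_img (a : chart N) : set 'rV[R]_n := chart_map a @` chart_dom a.

Definition smooth_function (W : set N) (f : N -> R) : Prop :=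
  forall a : chart N,
    smooth_on (chart_map a @` (W `&` chart_dom a)) (f \o chart_inv a).

(* Tensor fields are given by their coefficients in all charts, as functions of
   the coordinates; only the values on [chart_img a] are relevant. *)
Definition bivector_coefs := chart N -> 'I_n -> 'I_n -> 'rV[R]_n -> R.
Definition trivector_coefs :=
  chart N -> 'I_n -> 'I_n -> 'I_n -> 'rV[R]_n -> R.

(* [transition_jac a b x k i] is the derivative at x of the i-th coordinate of
   the chart b with respect to the k-th coordinate of the chart a. *)
Definition transition_jac (a b : chart N) (x : N) : 'M[R]_n :=
  jacobian (chart_map b \o chart_inv a) (chart_map a x).

Definition bivector_field (P : bivector_coefs) : Prop :=
  [/\ forall a i j, smooth_on (chart_img a) (P a i j),
      forall a i j y, chart_img a y -> P a i j y = - P a j i y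
    & forall a b x i j, chart_dom a x -> chart_dom b x ->
        P b i j (chart_map b x) =
        \sum_(k < n) \sum_(l < n)
          transition_jac a b x k i * transition_jac a b x l j *
          P a k l (chart_map a x)].

Definition trivector_field (T : trivector_coefs) : Prop :=
  [/\ forall a i j k, smooth_on (chart_img a) (T a i j k),
      forall a i j k y, chart_img a y ->
        T a i j k y = - T a j i k y /\ T a i j k y = - T a i k j y
    & forall a b x i j k, chart_dom a x -> chart_dom b x ->
        T b i j k (chart_map b x) =
        \sum_(p < n) \sum_(q < n) \sum_(r < n)
          transition_jac a b x p i * transition_jac a b x q j *
          transition_jac a b x r k * T a p q r (chart_map a x)].

(* A monomial in jets: a coefficient function, times any number of derivatives
   of components of a bivector, times one derivative of a component of a
   trivector.  A derivative of a component is encoded by the list of the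
   directions of differentiation and the indices of the component. *)
Record diff_monomial := DiffMonomial {
  dm_coef : 'rV[R]_n -> R ;
  dm_bivector : seq (seq 'I_n * ('I_n * 'I_n)) ;
  dm_trivector : seq 'I_n * ('I_n * 'I_n * 'I_n)
}.

Definition dm_eval (m : diff_monomial) (P : 'I_n -> 'I_n -> 'rV[R]_n -> R)
    (T : 'I_n -> 'I_n -> 'I_n -> 'rV[R]_n -> R) (y : 'rV[R]_n) : R :=
  let: (s, (i, j, k)) := dm_trivector m in
  dm_coef m y *
  (\prod_(p <- dm_bivector m) partials p.1 (P p.2.1 p.2.2) y) *
  partials s (T i j k) y.

Definition dm_bounded (d r : nat) (m : diff_monomial) : Prop :=
  [/\ (size (dm_bivector m) <= d)%N,
      all (fun p => size p.1 <= r)%N (dm_bivector m)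
    & (size (dm_trivector m).1 <= r)%N].

(* Maps of bivector and trivector fields to trivector fields whose coefficients
   are, in each chart, differential polynomials of bounded degree and order,
   linear in the trivector. *)
Definition polydiff_operator
    (D : bivector_coefs -> trivector_coefs -> trivector_coefs) : Prop :=
  (forall P T, bivector_field P -> trivector_field T ->
     trivector_field (D P T)) /\
  exists d r : nat, forall (a : chart N) (i j k : 'I_n),
    exists (q : nat) (m : 'I_q -> diff_monomial),
      (forall t,
         smooth_on (chart_img a) (dm_coef (m t)) /\ dm_bounded d r (m t)) /\
      forall P T, bivector_field P -> trivector_field T ->
        forall y, chart_img a y ->
          D P T a i j k y = \sum_(t < q) dm_eval (m t) (P a) (T a) y.

End fields.

Section brackets.
Context {R : realType} {n : nat}.
Implicit Types (P A B : 'I_n -> 'I_n -> 'rV[R]_n -> R).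
Implicit Types (T : 'I_n -> 'I_n -> 'I_n -> 'rV[R]_n -> R).
Implicit Types (f g h : 'rV[R]_n -> R).

(* The bivector sum_ij A^ij d_i /\ d_j acting on (f, g); the coefficients A^ij
   are not assumed to be antisymmetric. *)
Definition bivector_apply A f g : 'rV[R]_n -> R := fun y =>
  \sum_(i < n) \sum_(j < n)
    A i j y * (partial i f y * partial j g y - partial j f y * partial i g y).

Definition trivector_apply T f g h : 'rV[R]_n -> R := fun y =>
  \sum_(a < n) \sum_(b < n) \sum_(c < n)
    T a b c y * partial a f y * partial b g y * partial c h y.

Definition schouten A B f g h : 'rV[R]_n -> R :=
  let term f1 f2 f3 y :=
    bivector_apply A (bivector_apply B f1 f2) f3 y +
    bivector_apply B (bivector_apply A f1 f2) f3 y in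
  fun y => term f g h y + term g h f y + term h f g y.

Definition jacobiator P (a b c : 'I_n) : 'rV[R]_n -> R := fun y =>
  \sum_(s < n) (partial s (P a b) y * P s c y +
                partial s (P b c) y * P s a y +
                partial s (P c a) y * P s b y).

Definition Gamma1 P (i j : 'I_n) : 'rV[R]_n -> R := fun y =>
  \sum_(k < n) \sum_(l < n) \sum_(m < n)
  \sum_(k' < n) \sum_(l' < n) \sum_(m' < n)
    partials [:: k; l; m] (P i j) y * partial l' (P k k') y *
    partial m' (P l l') y * partial k' (P m m') y.

Definition Gamma2 P (i m : 'I_n) : 'rV[R]_n -> R := fun y =>
  \sum_(j < n) \sum_(k < n) \sum_(l < n)
  \sum_(k' < n) \sum_(l' < n) \sum_(m' < n)
    partials [:: k; l] (P i j) y * partials [:: k'; l'] (P k m) y *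
    partial m' (P k' l) y * partial j (P m' l') y.

(* Coefficients with respect to the d_i /\ d_j, to be used with
   [bivector_apply]; those of Gamma2 are not antisymmetric. *)
Definition tetrahedral_flow P (i j : 'I_n) : 'rV[R]_n -> R := fun y =>
  4^-1 * Gamma1 P i j y + 3 / 2 * Gamma2 P i j y.

End brackets.

(* ((t3, t3'), (t4, t4'), (t5, t5'), (u, v, w)) lists the targets of the arrows
   issued from the vertices 3, 4, 5 and from the Jacobiator vertex, which is
   numbered 6 (= J); the sinks are 0, 1, 2. *)
Definition leibniz_graph : Type :=
  (nat * nat) * (nat * nat) * (nat * nat) * (nat * nat * nat).

Definition leibniz_operator {R : realType} {n : nat} (L : leibniz_graph)
    (P : 'I_n -> 'I_n -> 'rV[R]_n -> R)
    (T : 'I_n -> 'I_n -> 'I_n -> 'rV[R]_n -> R)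
    (f g h : 'rV[R]_n -> R) (y : 'rV[R]_n) : R :=
  let: ((t3, t3'), (t4, t4'), (t5, t5'), (u, v, w)) := L in
  \sum_(i3 < n) \sum_(j3 < n) \sum_(i4 < n) \sum_(j4 < n)
  \sum_(i5 < n) \sum_(j5 < n) \sum_(a < n) \sum_(b < n) \sum_(c < n)
    let arrows := [:: (t3, i3); (t3', j3); (t4, i4); (t4', j4);
                      (t5, i5); (t5', j5); (u, a); (v, b); (w, c)] in
    let content k F := partials [seq e.2 | e <- arrows & e.1 == k] F y in
    content 0%N f * content 1%N g * content 2%N h *
    content 3%N (P i3 j3) * content 4%N (P i4 j4) * content 5%N (P i5 j5) *
    content 6%N (T a b c).

Section diamond.
Local Open Scope nat_scope.
Let J := 6.

Definition diamond : seq (leibniz_graph * int) := [::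
  (((4,J), (5,J), (3,J), (0,1,2)), (-1)%Z);
  (((0,4), (1,5), (2,3), (3,4,5)), (-3)%Z);
  (((0,4), (2,5), (1,3), (3,4,5)), 3%Z);
  (((0,4), (1,2), (3,4), (3,4,5)), (-3)%Z);
  (((0,1), (2,3), (3,4), (3,4,5)), (-3)%Z);
  (((0,2), (1,3), (3,4), (3,4,5)), 3%Z);
  (((4,5), (1,J), (4,J), (0,2,3)), (-3)%Z);
  (((4,5), (0,J), (4,J), (1,2,3)), 3%Z);
  (((5,J), (3,5), (2,J), (0,1,4)), (-3)%Z);
  (((1,4), (5,J), (3,J), (0,2,3)), 3%Z);
  (((0,4), (5,J), (3,J), (1,2,3)), (-3)%Z);
  (((5,J), (2,3), (4,J), (0,1,4)), (-3)%Z);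
  (((1,2), (3,5), (3,J), (0,3,4)), 3%Z);
  (((0,2), (3,5), (3,J), (1,3,4)), (-3)%Z);
  (((4,J), (0,1), (3,4), (2,4,5)), (-3)%Z);
  (((1,5), (3,5), (2,J), (0,3,4)), (-3)%Z);
  (((1,5), (3,5), (0,J), (2,3,4)), 3%Z);
  (((0,5), (3,5), (2,J), (1,3,4)), 3%Z);
  (((2,5), (3,5), (1,J), (0,3,4)), 3%Z);
  (((2,5), (3,5), (0,J), (1,3,4)), (-3)%Z);
  (((0,5), (3,5), (1,J), (2,3,4)), (-3)%Z);
  (((1,4), (2,5), (3,J), (0,3,4)), (-3)%Z);
  (((1,5), (2,3), (4,J), (0,3,4)), (-3)%Z);
  (((0,4), (2,5), (3,J), (1,3,4)), 3%Z);
  (((0,5), (2,3), (4,J), (1,3,4)), 3%Z);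
  (((4,J), (0,5), (1,3), (2,4,5)), (-3)%Z);
  (((4,J), (1,5), (0,3), (2,4,5)), 3%Z)].

End diamond.

Definition diamond_operator {R : realType} {n : nat}
    (P : 'I_n -> 'I_n -> 'rV[R]_n -> R)
    (T : 'I_n -> 'I_n -> 'I_n -> 'rV[R]_n -> R)
    (f g h : 'rV[R]_n -> R) (y : 'rV[R]_n) : R :=
  \sum_(L <- diamond) L.2%:~R * leibniz_operator L.1 P T f g h y.

(* Main.v *)
Require Import Defs.
From mathcomp Require Import all_boot all_order all_algebra.
From mathcomp Require Import all_classical all_reals all_analysis.
From mathcomp Require Import ring lra.
Import Order.TTheory GRing.Theory Num.Theory.
Import numFieldNormedType.Exports.

(** In a chart, both sides of the factorization are full contractions of iterated
    partial derivatives of the components of [P] and of [f], [g], [h], that is,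
    integral combinations of directed graphs: each vertex carries a copy of [P]
    or one of the functions, each arrow is a summation index that leaves a tensor
    and differentiates the content of the vertex it enters. Two such graphs have
    the same value up to sign when they differ by the names of the arrows, the
    order of the vertices, the order of the derivatives at a vertex (Schwarz's
    theorem, [partialC]) or the order of the two arrows leaving a bivector
    (antisymmetry). After all derivatives have been distributed by the Leibniz
    rule, the theorem holds because the two combinations of graphs agree up to
    these moves, and up to graphs that an automorphism shows to be equal to their
    own opposite. This is a finite verification: [dexpr] is a syntax for the
    expressions in the statement, [vanishes] expands them and compares canonical
    forms, [vanishes_sound] proves that a positive answer implies the vanishing
    of the expression for all smooth antisymmetric tensors, and
    [factorization_vanishes] runs it on the difference of the two sides.

    It remains to see that the sum of Leibniz graphs is a polydifferential
    operator with values in trivector fields, for an arbitrary trivector field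
    in place of the Jacobiator. In each graph every sink receives exactly one
    arrow, so the operator is of first order in each function and its
    coefficients are its values on coordinate functions ([diamond_coord]). Its
    antisymmetry is again an identity between graphs ([diamond_skew]). Each arrow
    contracts an upper index of a tensor with a derivative, so under an affine
    change of coordinates, whose higher derivatives vanish, the matrix produced
    by the tensor at the source is the one produced by the chain rule at the
    target ([contraction_affine]): the coefficients transform as those of a
    trivector ([diamond_trivector_field]). Finally, for each choice of the indices
    a graph is a monomial of degree three in the derivatives of [P] and of degree
    one in those of the trivector ([jet_polynomial_leibniz]). *)

Set Implicit Arguments.
Unset Strict Implicit.
Unset Printing Implicit Defensive.
Local Open Scope classical_set_scope.
Local Open Scope ring_scope.

(** * Smooth functions on an open set of coordinates *)

Section smooth_calculus.
Context {R : realType} {n : nat}.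
Implicit Types (f g : 'rV[R]_n -> R) (V : set 'rV[R]_n) (y v : 'rV[R]_n).

(** Partial derivatives at a point depend on the germ only; on an open set, equal
    functions may therefore be exchanged below any number of derivatives. *)
Lemma partial_eq_on V f g i y : open V -> V y -> (forall z, V z -> f z = g z) ->
  partial i f y = partial i g y.
Proof.
move=> oV Vy fg; apply: near_eq_derive.
have := open_nbhs_nbhs (conj oV Vy); exact: filterS.
Qed.

Lemma partials_eq_on V f g s y : open V -> V y -> (forall z, V z -> f z = g z) ->
  partials s f y = partials s g y.
Proof.
move=> oV Vy fg; elim: s y Vy => [|i s IH] y Vy /=; first exact: fg.
exact: (partial_eq_on _ oV Vy).
Qed.

Lemma partials_cat s1 s2 f : partials (s1 ++ s2) f = partials s1 (partials s2 f).
Proof. by rewrite /partials foldr_cat. Qed.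

Lemma smooth_on_sub V1 V2 f : V1 `<=` V2 -> smooth_on V2 f -> smooth_on V1 f.
Proof. by move=> V12 sf s y /V12 /(sf s). Qed.

Lemma smooth_on_partials V s f : smooth_on V f -> smooth_on V (partials s f).
Proof. by move=> sf s' y Vy; rewrite -partials_cat; apply: sf. Qed.

Lemma smooth_on_partial V i f : smooth_on V f -> smooth_on V (partial i f).
Proof. exact: (@smooth_on_partials V [:: i]). Qed.

Lemma smooth_on_derivable V f i y : smooth_on V f -> V y ->
  derivable f y (delta_mx 0 i).
Proof. by move=> sf Vy; have [_] := sf [::] y Vy; apply. Qed.

Arguments smooth_on_derivable {V f} i {y} _ _.

Lemma smooth_on_continuous V f y : smooth_on V f -> V y -> {for y, continuous f}.
Proof. by move=> sf Vy; have [] := sf [::] y Vy. Qed.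

Lemma smooth_on_eq V f g : open V -> (forall z, V z -> f z = g z) ->
  smooth_on V f -> smooth_on V g.
Proof.
move=> oV fg sf s y Vy; have [cf df] := sf s y Vy.
have nfg : \near y, partials s f y = partials s g y.
  have := open_nbhs_nbhs (conj oV Vy).
  by apply: filterS => z Vz; apply: (partials_eq_on _ oV Vz).
split=> [|i]; last exact: (near_eq_derivable nfg).
rewrite /prop_for /continuous_at -(nbhs_singleton nfg).
apply: cvg_trans cf; exact: near_eq_cvg nfg.
Qed.

(** Smoothness as a greatest fixed point: a class of C^1 functions that is stable,
    up to equality on [V], under partial derivatives consists of smooth
    functions. This spares computing the iterated derivatives of a product or of
    a composite. *)
Lemma smooth_on_coind V (Q : ('rV[R]_n -> R) -> Prop) : open V ->
  (forall f, Q f -> forall y, V y ->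
     {for y, continuous f} /\ forall i, derivable f y (delta_mx 0 i)) ->
  (forall f i, Q f -> exists2 g, Q g & forall y, V y -> partial i f y = g y) ->
  forall f, Q f -> smooth_on V f.
Proof.
move=> oV Qc Qd f Qf s.
suff [g Qg fg] : exists2 g, Q g & forall y, V y -> g y = partials s f y.
  move=> y Vy; have [cg dg] := Qc _ Qg y Vy.
  have ngf : \near y, g y = partials s f y.
    by have := open_nbhs_nbhs (conj oV Vy); apply: filterS.
  split=> [|i]; last exact: (near_eq_derivable ngf).
  rewrite /prop_for /continuous_at -(nbhs_singleton ngf).
  apply: cvg_trans cg; exact: near_eq_cvg ngf.
elim: s => [|i s [g Qg gf]] /=; first by exists f.
have [h Qh gh] := Qd g i Qg; exists h => // y Vy.
by rewrite -gh // (partial_eq_on _ oV Vy gf).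
Qed.

(** By the sum and product rules this class is stable under [partial], which is
    what [smooth_on_coind] asks for. *)
Inductive smooth_gen V : ('rV[R]_n -> R) -> Prop :=
| SmoothBase f : smooth_on V f -> smooth_gen V f
| SmoothAdd f g : smooth_gen V f -> smooth_gen V g -> smooth_gen V (f + g)
| SmoothMul f g : smooth_gen V f -> smooth_gen V g -> smooth_gen V (f * g).

Lemma smooth_gen_C1 V f : smooth_gen V f -> forall y, V y ->
  {for y, continuous f} /\ forall i, derivable f y (delta_mx 0 i).
Proof.
move=> sf y Vy; elim: sf => {f} [f sf|f g _ [cf df] _ [cg dg]|f g _ [cf df] _ [cg dg]].
- by split=> [|i]; [exact: smooth_on_continuous sf Vy | exact: smooth_on_derivable sf Vy].
- by split=> [|i]; [exact: continuousD | exact: derivableD].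
- by split=> [|i]; [exact: continuousM | exact: derivableM].
Qed.

Lemma smooth_gen_smooth V f : open V -> smooth_gen V f -> smooth_on V f.
Proof.
move=> oV; apply: (smooth_on_coind oV (@smooth_gen_C1 V)) => {}f i.
elim=> {f} [f sf|f g gf [f' sf' ff'] gg [g' sg' gg']|f g gf [f' sf' ff'] gg [g' sg' gg']].
- by exists (partial i f) => //; apply/SmoothBase/smooth_on_partial.
- exists (f' + g'); first exact: SmoothAdd.
  move=> y Vy; rewrite !fctE -ff' // -gg' //.
  have [_ /(_ i) df] := smooth_gen_C1 gf Vy; have [_ /(_ i) dg] := smooth_gen_C1 gg Vy.
  exact: (deriveD df dg).
- exists (f * g' + g * f'); first by apply: SmoothAdd; apply: SmoothMul.
  move=> y Vy; rewrite !fctE -ff' // -gg' //.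
  have [_ /(_ i) df] := smooth_gen_C1 gf Vy; have [_ /(_ i) dg] := smooth_gen_C1 gg Vy.
  exact: (deriveM df dg).
Qed.

Lemma smooth_onD V f g : open V -> smooth_on V f -> smooth_on V g ->
  smooth_on V (fun y => f y + g y).
Proof.
by move=> oV sf sg; apply: smooth_gen_smooth => //; apply: SmoothAdd; exact: SmoothBase.
Qed.

Lemma smooth_onM V f g : open V -> smooth_on V f -> smooth_on V g ->
  smooth_on V (fun y => f y * g y).
Proof.
by move=> oV sf sg; apply: smooth_gen_smooth => //; apply: SmoothMul; exact: SmoothBase.
Qed.

Lemma partial_cst (c : R) i y : partial i (fun=> c) y = 0.
Proof. by rewrite /partial derive_cst. Qed.

Lemma partial_cstE (c : R) i : partial i (fun=> c : R) = (fun=> 0) :> ('rV[R]_n -> R).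
Proof. by apply/funext => y; rewrite partial_cst. Qed.

Lemma smooth_on_cst V (c : R) : smooth_on V (fun=> c).
Proof.
move=> s y _; have [c' ->] : exists c', partials s (fun=> c) = (fun=> c') :> ('rV[R]_n -> R).
  elim: s => [|i s [c' /= ->]]; first by exists c.
  by exists 0; rewrite partial_cstE.
by split; [exact: cst_continuous | move=> i; exact: derivable_cst].
Qed.

Arguments smooth_on_cst : clear implicits.

Lemma smooth_on_sum V I (r : seq I) (F : I -> 'rV[R]_n -> R) : open V ->
  (forall i, smooth_on V (F i)) -> smooth_on V (fun y => \sum_(i <- r) F i y).
Proof.
move=> oV sF; elim: r => [|i r IH].
  apply: (smooth_on_eq oV _ (smooth_on_cst V 0)) => y _.
  by rewrite big_nil.
apply: (smooth_on_eq oV _ (smooth_onD oV (sF i) IH)) => y _.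
by rewrite big_cons.
Qed.

Arguments smooth_on_sum {V I} r {F} _ _.

Lemma smooth_on_prod V I (r : seq I) (F : I -> 'rV[R]_n -> R) : open V ->
  (forall i, smooth_on V (F i)) -> smooth_on V (fun y => \prod_(i <- r) F i y).
Proof.
move=> oV sF; elim: r => [|i r IH].
  apply: (smooth_on_eq oV _ (smooth_on_cst V 1)) => y _.
  by rewrite big_nil.
apply: (smooth_on_eq oV _ (smooth_onM oV (sF i) IH)) => y _.
by rewrite big_cons.
Qed.

Arguments smooth_on_prod {V I} r {F} _ _.

Lemma partialD V f g i y : smooth_on V f -> smooth_on V g -> V y ->
  partial i (fun z => f z + g z) y = partial i f y + partial i g y.
Proof.
move=> sf sg Vy; rewrite -[fun z => f z + g z]/(f + g).
exact: (deriveD (smooth_on_derivable i sf Vy) (smooth_on_derivable i sg Vy)).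
Qed.

Lemma partialM V f g i y : smooth_on V f -> smooth_on V g -> V y ->
  partial i (fun z => f z * g z) y = partial i f y * g y + f y * partial i g y.
Proof.
move=> sf sg Vy; rewrite -[fun z => f z * g z]/(f * g).
rewrite [LHS](deriveM (smooth_on_derivable i sf Vy) (smooth_on_derivable i sg Vy)).
by rewrite addrC [g y *: _]mulrC.
Qed.

Lemma partialZ V (c : R) f i y : smooth_on V f -> V y ->
  partial i (fun z => c * f z) y = c * partial i f y.
Proof.
move=> sf Vy; rewrite (partialM _ (smooth_on_cst V c) sf Vy).
by rewrite partial_cst mul0r add0r.
Qed.

Lemma partial_sum V I (r : seq I) (F : I -> 'rV[R]_n -> R) k y : open V -> V y ->
  (forall i, smooth_on V (F i)) ->
  partial k (fun z => \sum_(i <- r) F i z) y = \sum_(i <- r) partial k (F i) y.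
Proof.
move=> oV Vy sF; elim: r => [|i r IH].
  rewrite big_nil -[RHS](partial_cst 0 k y); congr (partial k _ y).
  by apply/funext=> z; rewrite big_nil.
rewrite big_cons -IH -(partialD _ (sF i) (smooth_on_sum r oV sF) Vy).
by congr (partial k _ y); apply/funext=> z; rewrite big_cons.
Qed.

Lemma partialsZ V (c : R) f s y : open V -> smooth_on V f -> V y ->
  partials s (fun z => c * f z) y = c * partials s f y.
Proof.
move=> oV sf; elim: s y => [|i s IH] y Vy //=.
apply: etrans (partial_eq_on _ oV Vy IH) _; apply: partialZ Vy.
exact: smooth_on_partials.
Qed.

Lemma partials_sum V I (r : seq I) (F : I -> 'rV[R]_n -> R) s y : open V -> V y ->
  (forall i, smooth_on V (F i)) ->
  partials s (fun z => \sum_(i <- r) F i z) y = \sum_(i <- r) partials s (F i) y.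
Proof.
move=> oV Vy sF; elim: s y Vy => [|k s IH] y Vy //=.
apply: etrans (partial_eq_on _ oV Vy IH) _; apply: partial_sum oV Vy _ => i.
exact: smooth_on_partials.
Qed.

End smooth_calculus.

(** * Mean values: directional derivatives, mixed partials, affine substitution *)

Section line_calculus.
Context {R : realType} {n : nat}.
Implicit Types (f g : 'rV[R]_n -> R) (V : set 'rV[R]_n) (y v w : 'rV[R]_n).

Lemma is_derive_line f w v (t : R) : derivable f (t *: v + w) v ->
  is_derive t 1 (fun t => f (t *: v + w)) ('D_v f (t *: v + w)).
Proof.
move=> df; set g := fun t => _.
have E : (fun h : R => h^-1 *: ((g \o shift t) (h *: (1 : R)) - g t)) =
         (fun h : R => h^-1 *: ((f \o shift (t *: v + w)) (h *: v) - f (t *: v + w))).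
  apply/funext => h; rewrite /g /=; congr (_ *: (f _ - _)).
  by rewrite scaler1 scalerDl addrA.
by apply: DeriveDef; rewrite /derivable /derive E.
Qed.

(** The mean value theorem along a line, in a form that covers both signs of the
    increment [c]. *)
Lemma MVT_line f w v (c : R) :
  (forall t : R, `|t| <= `|c| -> derivable f (t *: v + w) v) ->
  exists2 t, `|t| <= `|c| & f (c *: v + w) - f w = c * 'D_v f (t *: v + w).
Proof.
move=> df; pose g t := f (t *: v + w).
have g' (t : R) : `|t| <= `|c| -> is_derive t 1 g ('D_v f (t *: v + w)).
  by move=> /df; exact: is_derive_line.
have g0 : g 0 = f w by rewrite /g scale0r add0r.
have [c0|c0] := leP 0 c.
- have H (t : R) : t \in `[0, c] -> `|t| <= `|c|.
    by rewrite in_itv /= => /andP[t0 tc]; rewrite !ger0_norm.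
  have [||t /H tc] := @MVT_segment R g (fun t => 'D_v f (t *: v + w)) 0 c c0.
  + move=> t tc; apply/g'/H; exact: subset_itv_oo_cc tc.
  + by apply: derivable_within_continuous => t /H /g' [].
  by rewrite g0 subr0 mulrC; exists t.
- have H (t : R) : t \in `[c, 0] -> `|t| <= `|c|.
    by rewrite in_itv /= => /andP[tc t0]; rewrite !ler0_norm ?lerN2 // ltW.
  have [||t /H tc] := @MVT_segment R g (fun t => 'D_v f (t *: v + w)) c 0 (ltW c0).
  + move=> t tc; apply/g'/H; exact: subset_itv_oo_cc tc.
  + by apply: derivable_within_continuous => t /H /g' [].
  rewrite g0 sub0r => E; exists t => //; rewrite -/(g c) -opprB E; ring.
Qed.

(** The point is written [z + y] because the increments met below are sums of
    multiples of fixed vectors, whose norms are easy to bound. *)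
Lemma smooth_on_modulus V f y (e : R) : open V -> V y -> smooth_on V f -> 0 < e ->
  exists2 d, 0 < d & forall z, `|z| < d -> V (z + y) /\ `|f y - f (z + y)| < e.
Proof.
move=> oV Vy sf e0.
have /cvgrPdist_lt/(_ e e0) cf := smooth_on_continuous sf Vy.
have := iffLR (nbhs_normP _ _) (filterI (open_nbhs_nbhs (conj oV Vy)) cf).
rewrite /nbhs_ball_ => -[d /= d0 H].
exists d => // z zd; have [] // := H (z + y).
by rewrite /ball_ /= opprD addrCA subrr addr0 normrN.
Qed.

(** One axis at a time, the increment of [f] along [c *: e + w] splits into the
    increment along [w] and an increment along [e], which the mean value theorem
    turns into a nearby value of the continuous function [partial i f]. *)
Lemma is_derive_add_axis V f y w (c d : R) i : open V -> V y -> smooth_on V f ->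
  is_derive y w f d ->
  is_derive y (c *: delta_mx 0 i + w) f (c * partial i f y + d).
Proof.
move=> oV Vy sf [dw <-]; set e := delta_mx 0 i.
pose A (h : R) := h^-1 *: (f (h *: (c *: e) + (h *: w + y)) - f (h *: w + y)).
pose B (h : R) := h^-1 *: ((f \o shift y) (h *: w) - f y).
have EAB : (fun h : R => h^-1 *: ((f \o shift y) (h *: (c *: e + w)) - f y)) = A \+ B.
  apply/funext=> h; rewrite /A /B /= -scalerDr; congr (_ *: _).
  by rewrite [RHS]addrA subrK scalerDr -addrA.
have cA : A h @[h --> 0^'] --> c * partial i f y.
  apply/cvgrPdist_lt => eps eps0.
  (* The [+ 1] keeps the quotient defined when [c] vanishes. *)
  have e'0 : 0 < eps / (`|c| + 1) by rewrite divr_gt0 // ltr_wpDl.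
  have [dl dl0 H] := smooth_on_modulus oV Vy (smooth_on_partial i sf) e'0.
  pose K := `|c| * `|e| + `|w| + 1.
  have K0 : 0 < K by rewrite ltr_wpDl // addr_ge0 // mulr_ge0.
  have : \forall h \near (0:R)^', `|h| < dl / K.
    by apply: dnbhs0_lt; rewrite divr_gt0.
  apply: filter_app; apply: filter_app (nbhs_dnbhs_neq _); near=> h => h0 hdl.
  have small t : `|t| <= `|h * c| -> `|t *: e + h *: w| < dl.
    move=> tc; apply: le_lt_trans (ler_normD _ _) _; rewrite !normrZ.
    have : `|t| * `|e| <= `|h| * (`|c| * `|e|).
      by rewrite mulrA -normrM ler_wpM2r.
    move: hdl; rewrite ltr_pdivlMr // /K => hdl.
    have := normr_ge0 h; lra.
  have [|t tc E] := @MVT_line f (h *: w + y) e (h * c).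
    move=> t /small /H[]; rewrite -addrA => Vt _.
    exact: smooth_on_derivable sf Vt.
  rewrite /A scalerA E /GRing.scale /= mulrA mulrA mulVf // mul1r -mulrBr normrM.
  have [_] := H _ (small t tc); rewrite -addrA ltr_pdivlMr ?ltr_wpDl // => lt_eps.
  apply: le_lt_trans lt_eps; rewrite mulrC ler_wpM2l // lerDl //.
have cAB : (A \+ B) h @[h --> 0^'] --> c * partial i f y + 'D_w f y.
  exact: cvgD cA dw.
by apply: DeriveDef; rewrite /derivable /derive EAB; [exact: cvgP cAB | exact: cvg_lim cAB].
Unshelve. all: by end_near. Qed.

(** A C^1 function has a directional derivative in every direction, given by its
    partial derivatives: add the coordinates of [w] one by one. *)
Lemma is_derive_row V f y w : open V -> V y -> smooth_on V f ->
  is_derive y w f (\sum_i w 0 i * partial i f y).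
Proof.
move=> oV Vy sf; rewrite [X in is_derive _ X](row_sum_delta w).
elim/big_rec2: _ => [|i d u _]; first exact: is_derive0.
exact: is_derive_add_axis oV Vy sf.
Qed.

Lemma dist_le_halves (a b c e : R) :
  `|a - c| < e / 2 -> `|b - c| < e / 2 -> `|a - b| <= e.
Proof. by have := ler_distD c a b; rewrite (distrC c b); lra. Qed.

(** Schwarz's theorem. Two applications of the mean value theorem express the
    second difference of [f] over a small square as [h ^+ 2] times a mixed
    partial derivative at a nearby point. The second difference is symmetric in
    the two axes, so the two mixed partial derivatives take a common value
    arbitrarily close to [y]. *)
Lemma partialC V f i j y : open V -> V y -> smooth_on V f ->
  partial i (partial j f) y = partial j (partial i f) y.
Proof.
move=> oV Vy sf; apply/eqP; rewrite -subr_eq0 -normr_eq0.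
apply/eqP/le_anti; rewrite normr_ge0 andbT.
apply/ler_addgt0Pr => eps eps0; rewrite add0r.
have e20 : 0 < eps / 2 by rewrite divr_gt0.
(* The second difference over a square of side [h], for the axes [k] and [l]. *)
have mix k l : exists2 d, 0 < d & forall h, 0 < h -> h < d ->
    exists z, `|partial k (partial l f) y - partial k (partial l f) z| < eps / 2 /\
    f (h *: delta_mx 0 k + (h *: delta_mx 0 l + y)) - f (h *: delta_mx 0 k + y)
    - (f (h *: delta_mx 0 l + y) - f y) = h ^+ 2 * partial k (partial l f) z.
  set ek := delta_mx 0 k; set el := delta_mx 0 l.
  have skl : smooth_on V (partial k (partial l f)) by do 2!apply: smooth_on_partial.
  have [d d0 H] := smooth_on_modulus oV Vy skl e20.
  (* A bound for the vectors spanning the square, so that a side below [d / K]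
     keeps it inside the ball of radius [d]. *)
  pose K := `|ek| + `|el| + 1.
  have K0 : 0 < K by rewrite ltr_wpDl // addr_ge0.
  exists (d / K) => [|h h0]; first by rewrite divr_gt0.
  rewrite ltr_pdivlMr // => hd.
  have small a b : `|a| <= `|h| -> `|b| <= `|h| -> `|a *: ek + b *: el| < d.
    move=> ah bh; apply: le_lt_trans (ler_normD _ _) _; rewrite !normrZ.
    have : `|a| * `|ek| <= `|h| * `|ek| by rewrite ler_wpM2r.
    have : `|b| * `|el| <= `|h| * `|el| by rewrite ler_wpM2r.
    rewrite (gtr0_norm h0); move: hd; rewrite /K; lra.
  pose g z := f (h *: ek + z) - f z.
  have dfs a b : `|a| <= `|h| -> `|b| <= `|h| -> V (a *: ek + (b *: el + y)).
    by move=> ah bh; have [+ _] := H _ (small a b ah bh); rewrite -addrA.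
  have dg b : `|b| <= `|h| ->
      is_derive (b *: el + y) el g (partial l f (h *: ek + (b *: el + y)) - partial l f (b *: el + y)).
    move=> bh.
    have d1 : is_derive (h *: ek + (b *: el + y)) el f (partial l f (h *: ek + (b *: el + y))).
      by split=> //; apply: smooth_on_derivable sf (dfs _ _ (lexx _) bh).
    have d2 : is_derive (b *: el + y) el f (partial l f (b *: el + y)).
      split=> //; apply: smooth_on_derivable sf _.
      by have := dfs 0 b; rewrite scale0r add0r normr0; apply.
    apply: is_deriveB d2.
    have E : (fun t : R => t^-1 *: (((fun z => f (h *: ek + z)) \o shift (b *: el + y)) (t *: el) -
                   f (h *: ek + (b *: el + y)))) =
       (fun t : R => t^-1 *: ((f \o shift (h *: ek + (b *: el + y))) (t *: el) - f (h *: ek + (b *: el + y)))).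
      by apply/funext=> t /=; rewrite addrCA.
    by case: d1 => d1 v1; apply: DeriveDef; rewrite /derivable /derive E.
  have [|b bh E] := @MVT_line g y el h; first by move=> b /dg[].
  have [_ v] := dg b bh.
  have [|a ah Ea] := @MVT_line (partial l f) (b *: el + y) ek h.
    move=> a ah; apply: smooth_on_derivable (smooth_on_partial l sf) _.
    exact: dfs.
  exists (a *: ek + (b *: el + y)); split.
    by have [_] := H _ (small a b ah bh); rewrite -addrA.
  have -> : f (h *: ek + (h *: el + y)) - f (h *: ek + y) - (f (h *: el + y) - f y)
            = g (h *: el + y) - g y by rewrite /g; ring.
  by rewrite E v Ea expr2 mulrA.
have [d1 d10 H1] := mix i j; have [d2 d20 H2] := mix j i.
pose h := Num.min d1 d2 / 2.
have h0 : 0 < h by rewrite divr_gt0 // lt_min d10.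
have hmin : h < Num.min d1 d2 by rewrite /h ltr_pdivrMr // ltr_pMr ?ltr1n // lt_min d10.
move: (hmin); rewrite lt_min => /andP[hd1 hd2].
have [z1 [n1 E1]] := H1 h h0 hd1; have [z2 [n2 E2]] := H2 h h0 hd2.
have E : partial i (partial j f) z1 = partial j (partial i f) z2.
  have h20 : h ^+ 2 != 0 by rewrite expf_neq0 // gt_eqF.
  apply: (mulfI h20); apply: etrans (esym E1) _; apply: etrans _ E2.
  have swap (p q r t : R) : p - q - (r - t) = p - r - (q - t) by ring.
  by rewrite swap addrCA.
move: n1 n2; rewrite E.
move: (partial i _ y) (partial j _ y) (partial j _ z2) => a b c n1 n2.
exact: dist_le_halves n1 n2.
Qed.

(** Only the multiset of the directions of differentiation matters: this is what
    makes the arrows entering a vertex of a graph unordered. *)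
Lemma partials_perm V f s1 s2 y : open V -> V y -> smooth_on V f ->
  perm_eq s1 s2 -> partials s1 f y = partials s2 f y.
Proof.
move=> oV Vy sf; elim: s1 s2 y Vy => [|i s1 IH] s2 y Vy.
  by rewrite perm_sym => /perm_nilP ->.
move=> p12; have is2 : i \in s2 by rewrite -(perm_mem p12) mem_head.
have [s3 [s4 E]] : exists s3 s4, s2 = s3 ++ i :: s4.
  by case/splitPr: is2 => s3 s4; exists s3, s4.
have p' : perm_eq s1 (s3 ++ s4).
  by rewrite -(perm_cons i); apply: perm_trans p12 _; rewrite E perm_catC perm_cons perm_catC.
rewrite E.
have -> : partials (s3 ++ i :: s4) f y = partials (i :: s3 ++ s4) f y.
  rewrite partials_cat /= partials_cat.
  have := smooth_on_partials s4 sf; set g := partials s4 f => sg.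
  elim: s3 y Vy {E p'} => [|j s3 IH3] y Vy //=.
  have -> : partial j (partials s3 (partial i g)) y = partial j (partial i (partials s3 g)) y.
    by apply: partial_eq_on oV Vy _.
  by apply: partialC oV Vy _; apply: smooth_on_partials.
by apply: partial_eq_on oV Vy _ => z Vz; apply: IH.
Qed.

End line_calculus.

Section affine_substitution.
Context {R : realType} {m : nat}.
Variables (A : 'M[R]_m) (v : 'rV[R]_m) (V V' : set 'rV[R]_m).
Hypotheses (oV : open V) (oV' : open V').
Let phi (y : 'rV[R]_m) := y *m A + v.
Hypothesis phiV : forall y, V y -> V' (phi y).

Lemma affine_continuous : continuous phi.
Proof.
move=> y; apply: differentiable_continuous; apply: differentiableD => //.
have -> : mulmx^~ A = \sum_k (fun y : 'rV[R]_m => y 0 k *: row k A).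
  by apply/funext => z; rewrite mulmx_sum_row fct_sumE.
apply: differentiable_sum => k; apply: differentiableZl.
exact: differentiable_coord.
Qed.

(** The difference quotient of [f \o phi] along the axis [i] is literally the one
    of [f] along the row [i] of [A]. *)
Lemma is_derive_affine f y i : V y -> smooth_on V' f ->
  is_derive y (delta_mx 0 i) (f \o phi) (\sum_k A i k * partial k f (phi y)).
Proof.
move=> Vy sf.
have := is_derive_row (row i A) oV' (phiV Vy) sf.
rewrite (eq_bigr (fun k => A i k * partial k f (phi y))); last by move=> k _; rewrite mxE.
move=> [d1 v1].
have E : (fun h : R => h^-1 *: (((f \o phi) \o shift y) (h *: delta_mx 0 i) - (f \o phi) y)) =
         (fun h : R => h^-1 *: ((f \o shift (phi y)) (h *: row i A) - f (phi y))).
  apply/funext=> h /=; congr (_ *: (f _ - _)).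
  by rewrite /phi mulmxDl -addrA -scalemxAl -rowE.
by apply: DeriveDef; rewrite /derivable /derive E.
Qed.

Lemma partial_affine f y i : V y -> smooth_on V' f ->
  partial i (f \o phi) y = \sum_k A i k * partial k f (phi y).
Proof. by move=> Vy sf; have [] := is_derive_affine i Vy sf. Qed.

(** By the chain rule, the composites of smooth functions with [phi] form a class
    stable under [partial]. *)
Lemma smooth_on_affine f : smooth_on V' f -> smooth_on V (f \o phi).
Proof.
move=> sf; pose Q h := exists2 g, smooth_on V' g & h = g \o phi.
apply: (@smooth_on_coind _ _ _ Q oV) => [h [g sg ->] y Vy|h i [g sg ->]|]; last by exists f.
- split=> [|i]; last by have [] := is_derive_affine i Vy sg.
  apply: continuous_comp; last exact: smooth_on_continuous sg (phiV Vy).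
  exact: affine_continuous.
- exists ((fun z => \sum_k A i k * partial k g z) \o phi).
    exists (fun z => \sum_k A i k * partial k g z); last by [].
 
    apply: smooth_on_sum oV' _ => k; apply: smooth_onM oV' _ _; first exact: smooth_on_cst.
    exact: smooth_on_partial.
  by move=> y Vy; rewrite partial_affine.
Qed.

End affine_substitution.

(** * Iterated sums over named indices *)

Section iterated_sums.
Context {R : comPzRingType} {n : nat}.
Notation env := (nat -> 'I_n).
Implicit Types (e : env) (F G : env -> R) (bs N : seq nat).

Definition update e x i : env := fun y => if y == x then i else e y.

(** Summation indices are named by natural numbers and their values kept in an
    environment, so that nested sums over any list of names can be permuted and
    renamed by reasoning on lists. *)
Fixpoint sum_over bs F e : R :=
  if bs is x :: bs' then \sum_(i < n) sum_over bs' F (update e x i) else F e.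

Definition reads N F : Prop := forall e e', {in N, e =1 e'} -> F e = F e'.

Lemma reads_sub N N' F : {subset N <= N'} -> reads N F -> reads N' F.
Proof. by move=> s r e e' ee'; apply: r => x /s /ee'. Qed.

Lemma eq_sum_over bs F G e : F =1 G -> sum_over bs F e = sum_over bs G e.
Proof. by move=> FG; elim: bs e => //= x bs IH e; apply: eq_bigr. Qed.

Lemma eq_sum_over_fixed x bs F G e : x \notin bs ->
  (forall e', e' x = e x -> F e' = G e') -> sum_over bs F e = sum_over bs G e.
Proof.
elim: bs e => [|y bs IH] e /= => [_ -> //|]; rewrite inE negb_or => /andP[xy xbs] FG.
have E i : update e y i x = e x by rewrite /update (negPf xy).
by apply: eq_bigr => i _; apply: IH => // e'; rewrite E; apply: FG.
Qed.

Lemma sum_over_env N bs F e e' : reads N F ->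
  (forall x, x \in N -> x \notin bs -> e x = e' x) -> sum_over bs F e = sum_over bs F e'.
Proof.
move=> rF; elim: bs e e' => [|y bs IH] e e' ee' /=; first by apply: rF => x xN; apply: ee'.
apply: eq_bigr => i _; apply: IH => x xN xbs; rewrite /update; case: eqP => // /eqP xy.
by apply: ee'; rewrite // inE negb_or xy.
Qed.

Lemma sum_over_reads N bs F : reads N F -> reads N (sum_over bs F).
Proof. by move=> rF e e' ee'; apply: (sum_over_env rF) => x xN _; apply: ee'. Qed.

Lemma sum_over_sum bs I (r : seq I) (F : I -> env -> R) e :
  sum_over bs (fun e => \sum_(j <- r) F j e) e = \sum_(j <- r) sum_over bs (F j) e.
Proof.
elim: bs e => //= x bs IH e; rewrite exchange_big /=; apply: eq_bigr => i _; exact: IH.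
Qed.

Lemma sum_over_mulr bs F (c : R) e : sum_over bs (fun e => c * F e) e = c * sum_over bs F e.
Proof. by elim: bs e => //= x bs IH e; rewrite mulr_sumr; apply: eq_bigr. Qed.

(** Fubini for a product: the two lists of bound names may be merged when neither
    captures a name of the other factor. *)
Lemma sum_over_mul N1 N2 b1 b2 F G e : reads N1 F -> reads N2 G ->
  all (fun x => x \notin N2) b1 -> all (fun x => x \notin N1) b2 ->
  sum_over b1 F e * sum_over b2 G e = sum_over (b1 ++ b2) (fun e => F e * G e) e.
Proof.
move=> rF rG + b2N; elim: b1 e => [|x b1 IH] e /= => [_|/andP[xN b1N]].
  elim: b2 e b2N => //= y b2 IH e /andP[yN b2N]; rewrite mulr_sumr.
  apply: eq_bigr => i _; rewrite -IH //; congr (_ * _); apply: rF => z zN.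
  by rewrite /update; case: eqP => // zy; move: yN; rewrite -zy zN.
rewrite mulr_suml; apply: eq_bigr => i _; rewrite -IH //; congr (_ * _).
apply: (sum_over_env rG) => z zN _.
by rewrite /update; case: eqP => // zx; move: xN; rewrite -zx zN.
Qed.

(** Used with two copies of the same list of names, one for the arrows seen from
    their sources and one for the arrows seen from their targets. *)
Lemma sum_over_exchange b1 b2 (H : env -> env -> R) e1 e2 :
  sum_over b1 (fun o => sum_over b2 (H o) e2) e1 = sum_over b2 (fun k => sum_over b1 (H^~ k) e1) e2.
Proof.
elim: b1 e1 => [|x b1 IH] e1 //=; rewrite sum_over_sum; apply: eq_bigr => i _; exact: IH.
Qed.

Lemma update_swap e x y i j : x != y -> update (update e x i) y j =1 update (update e y j) x i.
Proof.
move=> xy z; rewrite /update; case: (z =P y) => // ->; case: (y =P x) => // yx.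
by rewrite yx eqxx in xy.
Qed.

Lemma sum_over_front N x bs F e : reads N F -> uniq (x :: bs) -> forall b1 b2,
  bs = b1 ++ b2 -> sum_over (x :: bs) F e = sum_over (b1 ++ x :: b2) F e.
Proof.
move=> rF /= /andP[xbs _] b1 b2 E; move: xbs; rewrite E {bs E}.
elim: b1 e => //= y b1 IH e; rewrite inE negb_or => /andP[xy xb].
transitivity (\sum_(j < n) sum_over (x :: b1 ++ b2) F (update e y j)); last first.
  by apply: eq_bigr => j _; rewrite -IH.
rewrite exchange_big /=; apply: eq_bigr => j _; apply: eq_bigr => i _.
by apply: sum_over_reads (rF) _ _ _ => z _; apply: update_swap.
Qed.

Lemma sum_over_perm N b1 b2 F e : reads N F -> uniq b1 -> perm_eq b1 b2 ->
  sum_over b1 F e = sum_over b2 F e.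
Proof.
move=> rF; elim: b1 b2 e => [|x b1 IH] b2 e; first by rewrite perm_sym => _ /perm_nilP ->.
move=> u p; have xb2 : x \in b2 by rewrite -(perm_mem p) mem_head.
have [b3 [b4 E]] : exists b3 b4, b2 = b3 ++ x :: b4.
  by case/splitPr: xb2 => s3 s4; exists s3, s4.
have p' : perm_eq b1 (b3 ++ b4).
  by rewrite -(perm_cons x); apply: perm_trans p _; rewrite E perm_catC perm_cons perm_catC.
have u' : uniq (x :: b3 ++ b4) by move: u; apply: etrans; apply: esym; apply: perm_uniq; rewrite perm_cons.
rewrite E -(sum_over_front _ rF u' (erefl _)) /=; apply: eq_bigr => i _; apply: IH => //.
by case/andP: u.
Qed.

(** The list [pre] records the names already bound on both sides, whose values
    agree. *)
Lemma sum_over_rename_aux ns ms (pre : seq (nat * nat)) F G e e' :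
  size ns = size ms -> uniq ns -> uniq ms ->
  (forall p, p \in pre -> p.1 \notin ns /\ p.2 \notin ms) ->
  (forall e e', (forall p, p \in pre ++ zip ns ms -> e p.1 = e' p.2) -> F e = G e') ->
  (forall p, p \in pre -> e p.1 = e' p.2) -> sum_over ns F e = sum_over ms G e'.
Proof.
elim: ns ms pre e e' => [|x ns IH] [|m ms] pre e e' //= sz.
  by move=> _ _ _; rewrite cats0; apply.
case: sz => sz /andP[xns u] /andP[mms u'] dj FG ee'; apply: eq_bigr => i _.
apply: (IH _ (rcons pre (x, m))) => //.
- move=> p; rewrite mem_rcons inE => /predU1P[->|/dj] //.
  by rewrite !inE !negb_or => -[/andP[_ ->] /andP[_ ->]].
- by move=> e1 e1' H; apply: FG => p ?; apply: H; rewrite cat_rcons.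
- move=> p; rewrite mem_rcons inE => /predU1P[->|pp]; first by rewrite /update !eqxx.
  have [] := dj p pp; rewrite !inE !negb_or => /andP[/negPf p1 _] /andP[/negPf p2 _].
  by rewrite /update p1 p2; apply: ee'.
Qed.

Lemma sum_over_rename ns F e e' : uniq ns -> reads ns F ->
  sum_over ns F e = sum_over (iota 0 (size ns)) (fun e => F (fun x => e (index x ns))) e'.
Proof.
move=> u rF; apply: (@sum_over_rename_aux _ _ [::]); rewrite ?size_iota ?iota_uniq //.
move=> e1 e1' H; apply: rF => x xns; apply: (H (x, index x ns)) => /=.
have lt : (index x ns < size ns)%N by rewrite index_mem.
apply/(nthP (x, 0%N)); exists (index x ns); first by rewrite size_zip size_iota minnn.
by rewrite nth_zip ?size_iota // nth_iota // nth_index.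
Qed.

End iterated_sums.

(** * Formal tensor expressions and their normal forms *)

Section syntax.
Local Open Scope nat_scope.

(** A vertex of a graph: its label, the names of its outgoing arrows (the indices
    of a tensor, in order) and the names of its incoming arrows (the
    derivatives acting on it). The labels are [0], [1], [2] for the sinks, [3]
    for the bivector and [4] for the trivector. *)
Definition factor : Type := nat * (seq nat * seq nat).
(** A graph with an integer coefficient: the coefficient, the summed arrows, the
    vertices. *)
Definition mono : Type := int * (seq nat * seq factor).

(** Tensor expressions as they occur in the statement, before any derivative has
    been distributed over products. [Der x] is the derivative along the index
    named [x], [Sum x] the summation over this index. *)
Inductive dexpr :=
| Zero
| Atom of nat & seq nat
| Add of dexpr & dexpr
| Mul of dexpr & dexpr
| Scale of int & dexpr
| Der of nat & dexpr
| Sum of nat & dexpr.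

Definition bound (m : mono) := m.2.1.
Definition factors (m : mono) := m.2.2.

Definition receive x (p : factor) : factor := (p.1, (p.2.1, x :: p.2.2)).

(** The derivative of a product of vertices: the arrow [x] enters each of them in
    turn. *)
Fixpoint product_rule x (fs : seq factor) : seq (seq factor) :=
  if fs is p :: fs' then (receive x p :: fs') :: [seq p :: g | g <- product_rule x fs'] else [::].

Definition mono_mul (p q : mono) : mono :=
  ((p.1 * q.1)%R, (bound p ++ bound q, factors p ++ factors q)).

Fixpoint expand (t : dexpr) : seq mono :=
  match t with
  | Zero => [::]
  | Atom l o => [:: (1%R, ([::], [:: (l, (o, [::]))]))]
  | Add a b => expand a ++ expand b
  | Mul a b => [seq mono_mul p q | p <- expand a, q <- expand b]
  | Scale z a => [seq ((z * m.1)%R, m.2) | m <- expand a]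
  | Der x a => flatten [seq [seq (m.1, (bound m, g)) | g <- product_rule x (factors m)] | m <- expand a]
  | Sum x a => [seq (m.1, (x :: bound m, factors m)) | m <- expand a]
  end.

Fixpoint bvars (t : dexpr) : seq nat :=
  match t with
  | Zero | Atom _ _ => [::]
  | Add a b | Mul a b => bvars a ++ bvars b
  | Scale _ a | Der _ a => bvars a
  | Sum x a => x :: bvars a
  end.

Fixpoint vars (t : dexpr) : seq nat :=
  match t with
  | Zero => [::]
  | Atom _ o => o
  | Add a b | Mul a b => vars a ++ vars b
  | Scale _ a => vars a
  | Der x a | Sum x a => x :: vars a
  end.

(** No summation captures an index of a cofactor or of a derivative, so that all
    sums may be pulled in front. *)
Fixpoint hygienic (t : dexpr) : bool :=
  match t with
  | Zero | Atom _ _ => true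
  | Add a b => hygienic a && hygienic b
  | Mul a b => [&& hygienic a, hygienic b, all (fun x => x \notin vars b) (bvars a) &
                   all (fun x => x \notin vars a) (bvars b)]
  | Scale _ a | Sum _ a => hygienic a
  | Der x a => hygienic a && (x \notin bvars a)
  end.

(** Insertion sort by [key], together with the parity of the number of
    transpositions used, which is the sign produced on antisymmetric
    coefficients. *)
Fixpoint insert (key : nat -> nat) x s : bool * seq nat :=
  if s is y :: s' then
    if key x <= key y then (false, x :: s)
    else let: (b, r) := insert key x s' in (~~ b, y :: r)
  else (false, [:: x]).

Fixpoint isort (key : nat -> nat) s : bool * seq nat :=
  if s is x :: s' then
    let: (b, r) := isort key s' in let: (b', r') := insert key x r in (b (+) b', r')
  else (false, [::]).

(** Sorting the outgoing arrows by the position of their targets makes the result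
    independent of the names of the arrows. *)
Definition target (fs : seq factor) x := find (fun p : factor => x \in p.2.2) fs.

Fixpoint sort_outs (key : nat -> nat) (fs : seq factor) : bool * seq factor :=
  if fs is p :: fs' then
    let: (b, o) := isort key p.2.1 in let: (b', fs'') := sort_outs key fs' in
    (b (+) b', (p.1, (o, p.2.2)) :: fs'')
  else (false, [::]).

Definition names (fs : seq factor) := flatten [seq p.2.1 | p : factor <- fs].

(** Once the arrows bear the numbers given by this order, isomorphic graphs in the
    same order become syntactically equal. *)
Definition renumber (fs : seq factor) : seq factor :=
  let ns := names fs in
  [seq (p.1, ([seq index x ns | x <- p.2.1], (isort id [seq index x ns | x <- p.2.2]).2)) | p : factor <- fs].

Definition arrange (fs : seq factor) : bool * seq factor :=
  let: (b, fs') := sort_outs (target fs) fs in (b, renumber fs').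

(** The vertices that carry the same content are interchangeable: all orders of
    the bivectors (label [3]) are tried, after the remaining vertices sorted by
    label. *)
Definition orderings (fs : seq factor) : seq (seq factor) :=
  let fixed := sort (fun p q : factor => p.1 <= q.1) [seq p : factor <- fs | p.1 != 3] in
  [seq fixed ++ q | q <- permutations [seq p : factor <- fs | p.1 == 3]].

Fixpoint lex (s t : seq nat) : bool :=
  match s, t with
  | x :: s', y :: t' => if x == y then lex s' t' else x < y
  | [::], _ => true
  | _, _ => false
  end.

(** Candidates are compared through the arrows that enter their vertices; [99]
    separates the vertices, as it exceeds every number of an arrow in the graphs
    at hand. *)
Definition code (fs : seq factor) := flatten [seq rcons p.2.2 99 | p : factor <- fs].

Fixpoint smallest (c0 : bool * seq factor) (cs : seq (bool * seq factor)) :=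
  if cs is c :: cs' then
    smallest (if lex (code c0.2) (code c.2) then c0 else c) cs'
  else c0.

Definition candidates fs := [seq arrange g | g <- orderings fs].

(** The least candidate is the canonical form. If it is also reached with the
    opposite sign, the graph has an automorphism that reverses its sign; its
    value is then zero and the graph is dropped. *)
Definition canon (m : mono) : seq (int * seq factor) :=
  let cs := candidates (factors m) in
  let c := smallest (head (arrange (factors m)) cs) cs in
  if has (fun d : bool * seq factor => (d.1 != c.1) && (d.2 == c.2)) cs then [::]
  else [:: (((-1) ^+ c.1 * m.1)%R, c.2)].

(** No index is free and every name determines the vertex it leaves, so that the
    arrows may be renamed. *)
Definition closed_mono (m : mono) : bool :=
  [&& uniq (bound m), perm_eq (names (factors m)) (bound m) &
      all (fun p : factor => all (fun x => x \in names (factors m)) p.2.2) (factors m)].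

Fixpoint collect (z : int) fs (acc : seq (int * seq factor)) :=
  if acc is c :: acc' then
    if c.2 == fs then ((c.1 + z)%R, fs) :: acc' else c :: collect z fs acc'
  else [:: (z, fs)].

Definition normal_form (ms : seq mono) :=
  foldr (fun c acc => collect c.1 c.2 acc) [::] (flatten (map canon ms)).

Definition bivec i j := Atom 3 [:: i; j].
Definition trivec i j k := Atom 4 [:: i; j; k].
Definition sink i := Atom i [::].

(** The contraction encoded by a Leibniz graph, with arbitrary expressions put
    into its vertices; with [jac_expr] in the last one, [expand] distributes the
    derivatives over the Jacobiator. *)
Definition graph_expr (L : leibniz_graph) (f g h : dexpr) (B : nat -> nat -> dexpr)
   (T : nat -> nat -> nat -> dexpr) : dexpr :=
  let: ((t3, t3'), (t4, t4'), (t5, t5'), (u, v, w)) := L in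
  let arrows := [:: (t3, 0); (t3', 1); (t4, 2); (t4', 3); (t5, 4); (t5', 5); (u, 6); (v, 7); (w, 8)] in
  let content k t := foldr Der t [seq e.2 | e <- arrows & e.1 == k] in
  foldr Sum
    (Mul (Mul (Mul (Mul (Mul (Mul (content 0 f) (content 1 g)) (content 2 h))
        (content 3 (B 0 1))) (content 4 (B 2 3))) (content 5 (B 4 5))) (content 6 (T 6 7 8)))
    (iota 0 9).

Definition diamond_expr f g h B T :=
  foldr (fun (L : leibniz_graph * int) t => Add (Scale L.2 (graph_expr L.1 f g h B T)) t) Zero diamond.

(** The name [s] of the summed index must differ from the arrows of the
    surrounding graph. *)
Definition jac_expr s (B : nat -> nat -> dexpr) a b c :=
  Sum s (Add (Add (Mul (Der s (B a b)) (B s c)) (Mul (Der s (B b c)) (B s a)))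
   (Mul (Der s (B c a)) (B s b))).

Definition biv_expr i j (A : nat -> nat -> dexpr) f g :=
  Sum i (Sum j (Mul (A i j) (Add (Mul (Der i f) (Der j g)) (Scale (-1)%R (Mul (Der j f) (Der i g)))))).

(** The names [0] to [3] are left to the Schouten bracket; the six summed indices
    are numbered from [4] on, in the order of the sums in [Gamma1] and
    [Gamma2]. *)
Definition gamma1_expr (P : nat -> nat -> dexpr) i j :=
  foldr Sum (Mul (Mul (Mul (foldr Der (P i j) [:: 4; 5; 6]) (Der 8 (P 4 7))) (Der 9 (P 5 8))) (Der 7 (P 6 9)))
  (iota 4 6).

Definition gamma2_expr (P : nat -> nat -> dexpr) i m :=
  foldr Sum (Mul (Mul (Mul (foldr Der (P i 4) [:: 5; 6]) (foldr Der (P 5 m) [:: 7; 8]))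
    (Der 9 (P 7 6))) (Der 4 (P 9 8)))
  (iota 4 6).

(** Four times the flow, so that all coefficients are integers. *)
Definition flow_expr (P : nat -> nat -> dexpr) i j :=
  Add (gamma1_expr P i j) (Scale 6%R (gamma2_expr P i j)).

Definition schouten_expr (A B : nat -> nat -> dexpr) f g h :=
  let term f1 f2 f3 := Add (biv_expr 0 1 A (biv_expr 2 3 B f1 f2) f3)
                           (biv_expr 0 1 B (biv_expr 2 3 A f1 f2) f3) in
  Add (Add (term f g h) (term g h f)) (term h f g).

(** A criterion for an expression to be zero for all smooth antisymmetric contents
    of its vertices; see [vanishes_sound]. *)
Definition vanishes t :=
  [&& hygienic t, all closed_mono (expand t) &
      all (fun c : int * seq factor => c.1 == 0%R) (normal_form (expand t))].

End syntax.

(** * Soundness of the normal forms *)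

Section semantics.
Context {R : realType} {n : nat}.
Notation env := (nat -> 'I_n).
Notation fn := ('rV[R]_n -> R).
Variable C : nat -> seq 'I_n -> fn.
Implicit Types (e : env) (y : 'rV[R]_n).

Definition factor_val e (p : factor) : fn := partials (map e p.2.2) (C p.1 (map e p.2.1)).
Definition factors_val e (fs : seq factor) : fn := fun y => \prod_(p <- fs) factor_val e p y.
Definition mono_val (m : mono) e : fn :=
  fun y => m.1%:~R * sum_over (bound m) (fun e' => factors_val e' (factors m) y) e.

Fixpoint denote (t : dexpr) e : fn :=
  match t with
  | Zero => fun=> 0
  | Atom l o => C l (map e o)
  | Add a b => fun y => denote a e y + denote b e y
  | Mul a b => fun y => denote a e y * denote b e y
  | Scale z a => fun y => z%:~R * denote a e y
  | Der x a => partial (e x) (denote a e)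
  | Sum x a => fun y => \sum_(i < n) denote a (update e x i) y
  end.

Variable V : set 'rV[R]_n.
Hypothesis oV : open V.
Hypothesis smoothC : forall l o, smooth_on V (C l o).

Lemma smooth_denote t e : smooth_on V (denote t e).
Proof.
elim: t e => [|l o|a IHa b IHb|a IHa b IHb|z a IHa|x a IHa|x a IHa] e //=.
- exact: smooth_on_cst.
- exact: smooth_onD.
- exact: smooth_onM.
- by apply: smooth_onM oV _ _ => //; apply: smooth_on_cst.
- exact: smooth_on_partial.
- exact: smooth_on_sum.
Qed.

Lemma smooth_factor_val e p : smooth_on V (factor_val e p).
Proof. exact: smooth_on_partials. Qed.

Lemma smooth_factors_val e fs : smooth_on V (factors_val e fs).
Proof. by apply: smooth_on_prod => // p; apply: smooth_factor_val. Qed.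

Lemma smooth_sum_over bs (F : env -> fn) e : (forall e, smooth_on V (F e)) ->
  smooth_on V (fun y => sum_over bs (fun e => F e y) e).
Proof.
move=> sF; elim: bs e => [|x bs IH] e /=; first exact: sF.
by apply: smooth_on_sum oV _ => i; apply: IH.
Qed.

Lemma smooth_mono_val m e : smooth_on V (mono_val m e).
Proof.
apply: smooth_onM oV _ _; first exact: smooth_on_cst.
by apply: smooth_sum_over => e'; apply: smooth_factors_val.
Qed.

Lemma partial_sum_over bs (F : env -> fn) e k y : V y -> (forall e, smooth_on V (F e)) ->
  partial k (fun y => sum_over bs (fun e => F e y) e) y =
  sum_over bs (fun e => partial k (F e) y) e.
Proof.
move=> Vy sF; elim: bs e => //= x bs IH e.
rewrite (partial_sum _ _ oV Vy) => [|i]; last exact: smooth_sum_over.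
by apply: eq_bigr => i _; apply: IH.
Qed.

Lemma partial_factors_val e x fs y : V y ->
  partial (e x) (factors_val e fs) y = \sum_(g <- product_rule x fs) factors_val e g y.
Proof.
move=> Vy; elim: fs => [|p fs IH] /=.
  rewrite big_nil -[RHS](partial_cst 1 (e x) y); congr (partial _ _ y).
  by apply/funext=> z; rewrite /factors_val big_nil.
have -> : factors_val e (p :: fs) = fun z => factor_val e p z * factors_val e fs z.
  by apply/funext=> z; rewrite /factors_val big_cons.
rewrite (partialM _ (smooth_factor_val e p) (smooth_factors_val e fs) Vy) IH big_cons big_map mulr_sumr.
congr (_ + _); first by rewrite /factors_val big_cons.
by apply: eq_bigr => g _; rewrite /factors_val big_cons.
Qed.

Definition factor_vars (fs : seq factor) := flatten [seq p.2.1 ++ p.2.2 | p : factor <- fs].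

Lemma factors_val_reads fs y : reads (factor_vars fs) (fun e => factors_val e fs y).
Proof.
move=> e e'; elim: fs => [|p fs IH] ee'; first by rewrite /factors_val !big_nil.
rewrite /factors_val !big_cons; congr (_ * _); last first.
  by apply: IH => x xs; apply: ee'; rewrite mem_cat xs orbT.
have ep x : x \in p.2.1 ++ p.2.2 -> e x = e' x by move=> xp; apply: ee'; rewrite mem_cat xp.
rewrite /factor_val; congr (partials _ (C _ _) y); apply/eq_in_map => x xp; apply: ep;
  by rewrite mem_cat xp ?orbT.
Qed.

Lemma mono_val_mul p q e y :
  all (fun x => x \notin factor_vars (factors q)) (bound p) ->
  all (fun x => x \notin factor_vars (factors p)) (bound q) ->
  mono_val (mono_mul p q) e y = mono_val p e y * mono_val q e y.
Proof.
move=> pq qp; rewrite /mono_val /= mulrACA -intrM; congr (_ * _).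
rewrite (sum_over_mul e (@factors_val_reads _ y) (@factors_val_reads _ y) pq qp).
by apply: eq_sum_over => e'; rewrite /factors_val big_cat.
Qed.

Lemma factor_vars_product_rule x fs g : g \in product_rule x fs -> {subset factor_vars g <= x :: factor_vars fs}.
Proof.
elim: fs g => //= p fs IH g; rewrite inE => /predU1P[->|/mapP[h hfs ->]] z.
  by rewrite /factor_vars /= !(mem_cat, inE); case: (z == x); rewrite ?orbT.
rewrite /factor_vars /= -/(factor_vars _) !inE !mem_cat -/(factor_vars _).
by case/orP=> [/orP[]->|/(IH _ hfs)]; rewrite ?orbT // inE => /orP[]->; rewrite ?orbT.
Qed.

Lemma expand_vars t m : m \in expand t ->
  {subset bound m <= bvars t} /\ {subset factor_vars (factors m) <= vars t}.
Proof.
elim: t m => [|l o|a IHa b IHb|a IHa b IHb|z a IHa|x a IHa|x a IHa] m //=.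
- by rewrite inE => /eqP -> /=; split=> //; rewrite /factor_vars /= !cats0.
- rewrite mem_cat => /orP[/IHa|/IHb] [sb sv]; split=> z;
    by [move/sb; rewrite mem_cat => -> | move/sv; rewrite mem_cat => ->
       | move/sb; rewrite mem_cat orbC => -> | move/sv; rewrite mem_cat orbC => ->].
- case/allpairsP=> -[p q] /= [/IHa[sb sv] /IHb[sb' sv'] ->]; split=> z /=.
    by rewrite !mem_cat => /orP[/sb|/sb'] ->; rewrite ?orbT.
  by rewrite /factor_vars map_cat flatten_cat !mem_cat => /orP[/sv|/sv'] ->; rewrite ?orbT.
- by case/mapP=> p /IHa[sb sv] ->.
- case/flatten_mapP=> p /IHa[sb sv] /mapP[g gp ->]; split=> //= z /(factor_vars_product_rule gp).
  by rewrite !inE => /orP[->|/sv ->]; rewrite ?orbT.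
- case/mapP=> p /IHa[sb sv] ->; split=> z /=; last by move/sv; rewrite inE => ->; rewrite orbT.
  by rewrite !inE => /orP[->|/sb ->]; rewrite ?orbT.
Qed.

(** By induction on the expression; the case of [Der] is the product rule, and
    those of [Mul] and [Der] need [hygienic] to move sums outwards. *)
Lemma expand_sound t e y : hygienic t -> V y ->
  denote t e y = \sum_(m <- expand t) mono_val m e y.
Proof.
elim: t e y => [|l o|a IHa b IHb|a IHa b IHb|z a IHa|x a IHa|x a IHa] e y /=.
- by rewrite big_nil.
- by rewrite big_seq1 /mono_val /factors_val /= big_seq1 mul1r.
- by case/andP=> ha hb Vy; rewrite big_cat /= -IHa // -IHb.
- case/and4P=> ha hb ab ba Vy; rewrite IHa // IHb // mulr_suml big_allpairs_dep.
  apply: eq_big_seq => p pa; rewrite mulr_sumr; apply: eq_big_seq => q qb.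
  have [bp vp] := expand_vars pa; have [bq vq] := expand_vars qb.
  by rewrite mono_val_mul //; apply/allP=> x; [move/bp/(allP ab) | move/bq/(allP ba)];
    apply: contra; [apply: vq | apply: vp].
- move=> ha Vy; rewrite IHa // big_map mulr_sumr; apply: eq_bigr => m _.
  by rewrite /mono_val /= intrM mulrA.
- case/andP=> ha xa Vy.
  rewrite (partial_eq_on _ oV Vy (fun z Vz => IHa e z ha Vz)).
  rewrite (partial_sum _ _ oV Vy) => [|m]; last exact: smooth_mono_val.
  rewrite big_flatten big_map /=; apply: eq_big_seq => m ma.
  have [bm _] := expand_vars ma.
  have sm e' : smooth_on V (factors_val e' (factors m)) by apply: smooth_factors_val.
  rewrite big_map /mono_val /= (partialZ _ _ (smooth_sum_over _ _ sm) Vy) -mulr_sumr -sum_over_sum.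
  congr (_ * _); rewrite (partial_sum_over _ _ _ Vy sm).
  apply: (@eq_sum_over_fixed _ _ x) => [|e' <-]; last exact: partial_factors_val.
  by apply: contra xa => /bm.
- move=> ha Vy; rewrite big_map; under eq_bigr do rewrite IHa //.
  rewrite exchange_big /=; apply: eq_bigr => m _; rewrite -mulr_sumr /=.
  by [].
Qed.

Hypothesis skewC : forall l o1 a b o2 y, V y ->
  C l (o1 ++ a :: b :: o2) y = - C l (o1 ++ b :: a :: o2) y.

Lemma insert_sound key x s l e pre y : V y ->
  C l (pre ++ map e (x :: s)) y =
  (-1) ^+ (insert key x s).1 * C l (pre ++ map e (insert key x s).2) y.
Proof.
move=> Vy; elim: s pre => [|z s IH] pre /=; first by rewrite mul1r.
case: ifP => _ /=; first by rewrite mul1r.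
have := IH (rcons pre (e z)); case: (insert key x s) => b r /=.
by rewrite !cat_rcons => E; rewrite skewC // E signrN mulNr.
Qed.

Lemma isort_sound key s l e pre y : V y ->
  C l (pre ++ map e s) y =
  (-1) ^+ (isort key s).1 * C l (pre ++ map e (isort key s).2) y.
Proof.
move=> Vy; elim: s pre => [|x s IH] pre /=; first by rewrite mul1r.
have := IH (rcons pre (e x)); case: (isort key s) => b r /=.
have := insert_sound key x r l e pre Vy; case: (insert key x r) => b' r' /=.
by rewrite !cat_rcons => E1 ->; rewrite E1 signr_addb mulrA.
Qed.

(** Antisymmetry survives differentiation, since it holds on an open set. *)
Lemma sort_outs_sound key fs e y : V y ->
  factors_val e fs y = (-1) ^+ (sort_outs key fs).1 * factors_val e (sort_outs key fs).2 y.
Proof.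
move=> Vy; elim: fs => [|p fs IH] /=; first by rewrite mul1r.
rewrite /factors_val big_cons -/(factors_val e fs y) IH.
case: (sort_outs key fs) => b' fs' /=.
case E: (isort key p.2.1) => [b o] /=; rewrite big_cons signr_addb mulrACA; congr (_ * _).
rewrite /factor_val /= -(partialsZ _ _ oV) //; apply: partials_eq_on oV Vy _ => z Vz.
by have := isort_sound key p.2.1 p.1 e [::] Vz; rewrite E.
Qed.

Lemma insert_perm key x s : perm_eq (insert key x s).2 (x :: s).
Proof.
elim: s => //= z s; case: ifP => //= _; case: (insert key x s) => b r /= p.
by rewrite -(perm_cons z) in p; apply: perm_trans p _; rewrite (perm_catCA [:: z] [:: x] s).
Qed.

Lemma isort_perm key s : perm_eq (isort key s).2 s.
Proof.
elim: s => //= x s; case: (isort key s) => b r /= p.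
have := insert_perm key x r; case: (insert key x r) => b' r' /= p'.
by apply: perm_trans p' _; rewrite perm_cons.
Qed.

Lemma names_sort_outs key fs : perm_eq (names (sort_outs key fs).2) (names fs).
Proof.
elim: fs => //= p fs; case: (sort_outs key fs) => b' fs' /= IH.
have := isort_perm key p.2.1; case: (isort key p.2.1) => b o /= po.
exact: perm_cat.
Qed.

Lemma ins_sort_outs key fs : [seq p.2.2 | p : factor <- (sort_outs key fs).2] = [seq p.2.2 | p : factor <- fs].
Proof.
elim: fs => //= p fs; case: (sort_outs key fs) => b' fs' /= IH.
by case: (isort key p.2.1) => b o /=; rewrite IH.
Qed.

Definition canon_val (c : int * seq factor) e : fn :=
  mono_val (c.1, (iota 0 (size (names c.2)), c.2)) e.

Lemma factor_vars_closed fs : all (fun p : factor => all (fun x => x \in names fs) p.2.2) fs ->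
  {subset factor_vars fs <= names fs}.
Proof.
move=> /allP cl x /flatten_mapP[p pfs]; rewrite mem_cat => /orP[xo|xi].
  by apply/flatten_mapP; exists p.
by have /allP := cl p pfs; apply.
Qed.

Lemma names_renumber fs : size (names (renumber fs)) = size (names fs).
Proof.
rewrite /names /renumber !size_flatten /shape -!map_comp; congr sumn.
by apply: eq_map => p /=; rewrite size_map.
Qed.

(** Renaming the summed indices and reordering the derivatives. *)
Lemma renumber_sound bs fs e e' y : V y -> uniq bs -> perm_eq (names fs) bs ->
  all (fun p : factor => all (fun x => x \in names fs) p.2.2) fs ->
  sum_over bs (fun e => factors_val e fs y) e =
  sum_over (iota 0 (size (names (renumber fs)))) (fun e => factors_val e (renumber fs) y) e'.
Proof.
move=> Vy ubs p cl.
have rd : reads (names fs) (fun e => factors_val e fs y).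
  by apply: reads_sub (@factors_val_reads fs y); apply: factor_vars_closed.
have un : uniq (names fs) by rewrite (perm_uniq p).
rewrite perm_sym in p; rewrite (sum_over_perm e rd ubs p) (sum_over_rename e e' un rd) names_renumber.
apply: eq_sum_over => e1; rewrite /factors_val /renumber big_map; apply: eq_bigr => q _.
have E s : [seq e1 (index x (names fs)) | x <- s] = map e1 [seq index x (names fs) | x <- s].
  by rewrite -map_comp.
rewrite /factor_val /= !E; apply: partials_perm oV Vy _ _ => //.
by apply: perm_map; rewrite perm_sym; apply: isort_perm.
Qed.

Lemma arrange_sound z bs fs e e' y : V y -> uniq bs -> perm_eq (names fs) bs ->
  all (fun p : factor => all (fun x => x \in names fs) p.2.2) fs ->
  mono_val (z, (bs, fs)) e y = canon_val ((-1) ^+ (arrange fs).1 * z, (arrange fs).2) e' y.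
Proof.
move=> Vy ubs p cl; rewrite /arrange.
have S e1 := sort_outs_sound (target fs) fs e1 Vy.
have N := names_sort_outs (target fs) fs; have I := ins_sort_outs (target fs) fs.
case: (sort_outs _ fs) S N I => b fs' /= S N I.
rewrite /canon_val /mono_val /= (eq_sum_over _ _ S) sum_over_mulr.
rewrite (@renumber_sound bs fs' e e') //; last 2 first.
- exact: perm_trans N p.
- have clE gs : all (fun p : factor => all (fun x => x \in names gs) p.2.2) gs =
     all (all (fun x => x \in names gs)) [seq p.2.2 | p : factor <- gs] by rewrite all_map.
  rewrite clE I; rewrite clE in cl; apply: sub_all cl => s; apply: sub_all => x.
  by rewrite (perm_mem N).
rewrite rmorphM rmorph_sign mulrA; congr (_ * _); exact: mulrC.
Qed.

Lemma orderings_perm fs g : g \in orderings fs -> perm_eq g fs.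
Proof.
case/mapP=> q; rewrite mem_permutations => pq ->; rewrite perm_sym.
rewrite -(perm_filterC (fun p : factor => p.1 == 3) fs) perm_catC.
by apply: perm_cat; rewrite perm_sym // perm_sort.
Qed.

Lemma candidate_sound m c e e' y : V y -> closed_mono m -> c \in candidates (factors m) ->
  mono_val m e y = canon_val ((-1) ^+ c.1 * m.1, c.2) e' y.
Proof.
case: m => z [bs fs] Vy /and3P[ubs p cl] /mapP[g /orderings_perm pg ->].
have png : perm_eq (names g) (names fs) by apply/perm_flatten/perm_map.
rewrite -(@arrange_sound _ bs _ e) //.
- rewrite /mono_val /=; congr (_ * _); apply: eq_sum_over => e1.
  by rewrite /factors_val; apply: perm_big; rewrite perm_sym.
- exact: perm_trans png p.
rewrite (perm_all _ pg); apply: sub_all cl => q; apply: sub_all => x.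
by rewrite (perm_mem png).
Qed.

Lemma smallest_mem c0 cs : smallest c0 cs \in c0 :: cs.
Proof.
elim: cs c0 => [|c cs IH] c0 /=; first exact: mem_head.
have := IH (if lex (code c0.2) (code c.2) then c0 else c).
by case: ifP => _; rewrite !inE => /orP[->|->]; rewrite ?orbT.
Qed.

(** The value of a closed graph depends neither on the order of its vertices nor
    on the names of its arrows, and antisymmetry accounts for the sign. When the
    canonical form comes with both signs, the value equals its own opposite. *)
Lemma canon_sound m e e' y : V y -> closed_mono m ->
  mono_val m e y = \sum_(c <- canon m) canon_val c e' y.
Proof.
move=> Vy cm; rewrite /canon; set cs := candidates _; set c := smallest _ _.
have cE : mono_val m e y = canon_val ((-1) ^+ c.1 * m.1, c.2) e' y.
  have := smallest_mem (head (arrange (factors m)) cs) cs; rewrite -/c inE => /orP[/eqP ->|].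
    case E: cs => [|c1 cs'] /=; last by apply: candidate_sound => //; rewrite -/cs E mem_head.
    by case/and3P: cm; case: (m) => z [bs fs] /= *; apply: arrange_sound.
  exact: candidate_sound.
case: hasP => [[d dcs /andP[d1 /eqP d2]]|_]; last by rewrite big_seq1.
rewrite big_nil; have dE := candidate_sound e e' Vy cm dcs.
have : canon_val ((-1) ^+ d.1 * m.1, d.2) e' y = - canon_val ((-1) ^+ c.1 * m.1, c.2) e' y.
  have -> : d.1 = ~~ c.1 by case: (d.1) (c.1) d1 => [] [].
  by rewrite d2 /canon_val /mono_val /= signrN mulNr rmorphN mulNr.
rewrite -dE -cE => /eqP; rewrite -addr_eq0 -mulr2n mulrn_eq0 => /eqP.
by [].
Qed.

Lemma collect_sound z fs acc e y :
  \sum_(c <- collect z fs acc) canon_val c e y = canon_val (z, fs) e y + \sum_(c <- acc) canon_val c e y.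
Proof.
elim: acc => [|c acc IH] /=; first by rewrite big_seq1 big_nil addr0.
case: eqP => [<-|_]; rewrite !big_cons; last by rewrite IH addrCA.
by rewrite addrA; congr (_ + _); case: c => z' fs'; rewrite /canon_val /mono_val /= intrD mulrDl addrC.
Qed.

Lemma normal_form_sound ms e e' y : V y -> all closed_mono ms ->
  \sum_(m <- ms) mono_val m e y = \sum_(c <- normal_form ms) canon_val c e' y.
Proof.
move=> Vy /allP cl; rewrite /normal_form.
have -> : \sum_(m <- ms) mono_val m e y = \sum_(c <- flatten (map canon ms)) canon_val c e' y.
  rewrite big_flatten big_map; apply: eq_big_seq => m /cl; exact: canon_sound.
elim: (flatten _) => [|c cs IH] /=; first by rewrite !big_nil.
by rewrite big_cons collect_sound IH; case: c.
Qed.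

(** An expression all of whose graphs cancel is zero, whatever smooth
    antisymmetric contents are put into the vertices. *)
Theorem vanishes_sound t e y : vanishes t -> V y -> denote t e y = 0.
Proof.
case/and3P=> ht ct /allP zt Vy; rewrite expand_sound // (@normal_form_sound _ e e) //.
rewrite big_seq big1 // => c /zt /eqP; rewrite /canon_val /mono_val => ->.
by rewrite mul0r.
Qed.

End semantics.

(** * Leibniz graphs as contractions of jets *)

Section diamond_operator_facts.
Context {R : realType} {n : nat}.
Notation env := (nat -> 'I_n).
Notation fn := ('rV[R]_n -> R).
Implicit Types (e : env) (y : 'rV[R]_n) (f g h : fn) (P : 'I_n -> 'I_n -> fn)
  (T : 'I_n -> 'I_n -> 'I_n -> fn).

(** What the labels of the vertices stand for. A wrong number of outgoing arrows
    gives the zero function, which keeps smoothness and antisymmetry free of side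
    conditions. *)
Definition content f g h P T (l : nat) (o : seq 'I_n) : fn :=
  match l, o with
  | 0%N, [::] => f
  | 1%N, [::] => g
  | 2%N, [::] => h
  | 3%N, [:: i; j] => P i j
  | 4%N, [:: i; j; k] => T i j k
  | _, _ => fun=> 0
  end.

(** The arrows are numbered in the order in which the encoding lists them, so that
    the vertices [3], [4], [5] and the last one emit consecutive numbers. *)
Definition arrows (L : leibniz_graph) : seq (nat * nat) :=
  let: ((t3, t3'), (t4, t4'), (t5, t5'), (u, v, w)) := L in
  zip [:: t3; t3'; t4; t4'; t5; t5'; u; v; w] (iota 0 9).

Definition incoming L k : seq nat := [seq a.2 | a <- arrows L & a.1 == k].

Definition graph_factors L : seq factor :=
  [:: (0, ([::], incoming L 0)); (1, ([::], incoming L 1)); (2, ([::], incoming L 2));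
      (3, ([:: 0; 1], incoming L 3)); (3, ([:: 2; 3], incoming L 4));
      (3, ([:: 4; 5], incoming L 5)); (4, ([:: 6; 7; 8], incoming L 6))]%N.

Lemma incoming_env e (A : seq (nat * nat)) k :
  [seq a.2 | a <- [seq (p.1, e p.2) | p <- A] & a.1 == k] =
  map e [seq a.2 | a <- A & a.1 == k].
Proof. by rewrite filter_map -!map_comp. Qed.

Lemma prod7 (F : factor -> R) a0 a1 a2 a3 a4 a5 a6 :
  \prod_(p <- [:: a0; a1; a2; a3; a4; a5; a6]) F p =
  F a0 * F a1 * F a2 * F a3 * F a4 * F a5 * F a6.
Proof. by rewrite !big_cons big_nil mulr1 !mulrA. Qed.

Lemma leibniz_operatorE L P T f g h y e :
  leibniz_operator L P T f g h y =
  sum_over (iota 0 9) (fun e => factors_val (content f g h P T) e (graph_factors L) y) e.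
Proof.
case: L => [[[[t3 t3'] [t4 t4']] [t5 t5']] [[u v] w]].
rewrite /leibniz_operator /=.
do 9![apply: eq_bigr => ? _].
rewrite /factors_val prod7 /factor_val /=.
by rewrite /incoming -!incoming_env.
Qed.

Lemma denote_ders (C : nat -> seq 'I_n -> fn) t xs e :
  denote C (foldr Der t xs) e = partials (map e xs) (denote C t e).
Proof. by elim: xs => //= x xs ->. Qed.

Lemma denote_sums (C : nat -> seq 'I_n -> fn) t bs e y :
  denote C (foldr Sum t bs) e y = sum_over bs (fun e => denote C t e y) e.
Proof. by elim: bs e => //= x bs IH e; apply: eq_bigr. Qed.

(** The contents of the vertices may be compound expressions; only their
    denotation at the names of the arrows matters. *)
Lemma denote_graph (C : nat -> seq 'I_n -> fn) L P T f g h F G H B U e y :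
  (forall e, denote C F e = f) -> (forall e, denote C G e = g) -> (forall e, denote C H e = h) ->
  (forall i j e, denote C (B i j) e = P (e i) (e j)) ->
  (forall e, denote C (U 6%N 7%N 8%N) e = T (e 6%N) (e 7%N) (e 8%N)) ->
  denote C (graph_expr L F G H B U) e y = leibniz_operator L P T f g h y.
Proof.
move=> dF dG dH dB dU; rewrite (leibniz_operatorE _ _ _ _ _ _ _ e).
rewrite /factors_val; case: L => [[[[t3 t3'] [t4 t4']] [t5 t5']] [[u v] w]].
rewrite denote_sums; apply: eq_sum_over => e'.
rewrite prod7.
cbn [denote]; rewrite !denote_ders dF dG dH !dB dU.
by [].
Qed.

Lemma denote_diamond (C : nat -> seq 'I_n -> fn) P T f g h F G H B U e y :
  (forall e, denote C F e = f) -> (forall e, denote C G e = g) -> (forall e, denote C H e = h) ->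
  (forall i j e, denote C (B i j) e = P (e i) (e j)) ->
  (forall e, denote C (U 6%N 7%N 8%N) e = T (e 6%N) (e 7%N) (e 8%N)) ->
  denote C (diamond_expr F G H B U) e y = diamond_operator P T f g h y.
Proof.
move=> dF dG dH dB dU; rewrite /diamond_operator /diamond_expr.
elim: diamond => [|L d IH]; first by rewrite big_nil.
by rewrite big_cons /= IH (denote_graph _ _ _ dF dG dH dB dU).
Qed.

Section smooth_content.
Variables (V : set 'rV[R]_n) (f g h : fn) (P : 'I_n -> 'I_n -> fn)
  (T : 'I_n -> 'I_n -> 'I_n -> fn).
Hypotheses (oV : open V) (sf : smooth_on V f) (sg : smooth_on V g) (sh : smooth_on V h)
  (sP : forall i j, smooth_on V (P i j)) (sT : forall i j k, smooth_on V (T i j k)).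

Lemma smooth_content l o : smooth_on V (content f g h P T l o).
Proof.
have s0 : smooth_on V (fun=> 0 : R) by exact: smooth_on_cst.
case: l => [|[|[|[|[|l]]]]].
- by case: o => [|? ?]; [exact: sf | exact: s0].
- by case: o => [|? ?]; [exact: sg | exact: s0].
- by case: o => [|? ?]; [exact: sh | exact: s0].
- by case: o => [|? [|? [|? ?]]]; [exact: s0 | exact: s0 | exact: sP | exact: s0].
- by case: o => [|? [|? [|? [|? ?]]]]; [exact: s0 | exact: s0 | exact: s0 | exact: sT | exact: s0].
- exact: s0.
Qed.

Lemma smooth_diamond (e : env) : smooth_on V (diamond_operator P T f g h).
Proof.
(* Smoothness is read off an expression that denotes the operator. *)
pose t := diamond_expr (sink 0) (sink 1) (sink 2) bivec trivec.
apply: (smooth_on_eq oV _ (smooth_denote oV smooth_content t e)) => y _.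
exact: denote_diamond.
Qed.

Hypothesis skewP : forall i j y, V y -> P i j y = - P j i y.
Hypothesis skewT : forall i j k y, V y -> T i j k y = - T j i k y /\ T i j k y = - T i k j y.

(** Stated for an arbitrary adjacent transposition, which is the only step of the
    insertion sort. *)
Lemma skew_content l o1 a b o2 y : V y ->
  content f g h P T l (o1 ++ a :: b :: o2) y = - content f g h P T l (o1 ++ b :: a :: o2) y.
Proof.
move=> Vy; case: l => [|[|[|[|[|l]]]]] /=.
- by case: o1 => [|i o1] /=; rewrite oppr0.
- by case: o1 => [|i o1] /=; rewrite oppr0.
- by case: o1 => [|i o1] /=; rewrite oppr0.
- case: o1 => [|i [|j o1]] /=.
  + by case: o2 => [|j o2] /=; [exact: skewP | rewrite oppr0].
  + by rewrite oppr0.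
  + by case: o1 => [|? o1] /=; rewrite oppr0.
- case: o1 => [|i [|j o1]] /=.
  + by case: o2 => [|k [|m o2]] /=; rewrite ?oppr0 //; have [] := skewT a b k Vy.
  + by case: o2 => [|k o2] /=; rewrite ?oppr0 //; have [] := skewT i a b Vy.
  + by case: o1 => [|k [|m o1]] /=; rewrite ?oppr0.
- by rewrite oppr0.
Qed.

End smooth_content.

Definition coord (i : 'I_n) : fn := fun y => y 0 i.

Lemma partial_coord i k : partial k (coord i) = fun=> (i == k)%:R.
Proof.
apply/funext => y; rewrite /partial /derive.
apply: (@cvg_lim _ (@Rhausdorff R)).
have E : {near (0 : R)^', (fun=> (i == k)%:R) =1
    (fun h : R => h^-1 *: ((coord i \o shift y) (h *: delta_mx 0 k) - coord i y))}.
  near=> h; have h0 : h != 0 by near: h; exact: nbhs_dnbhs_neq.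
  rewrite /coord /= !mxE addrK eqxx /= /GRing.scale /= mulrA mulVf // mul1r.
  by rewrite eq_sym.
by apply: cvg_trans (near_eq_cvg E) _; apply: cvg_cst.
Unshelve. all: by end_near. Qed.

Lemma smooth_coord V i : open V -> smooth_on V (coord i).
Proof.
move=> oV; pose Q (f : fn) := f = coord i \/ exists c, f = fun=> c.
apply: (@smooth_on_coind _ _ _ Q oV); last by left.
- move=> f [->|[c ->]] y Vy; last by split; [exact: cst_continuous | move=> k; exact: derivable_cst].
  by split=> [|k]; [exact: coord_continuous | exact/diff_derivable/differentiable_coord].
- move=> f k [->|[c ->]]; last by exists (fun=> 0) => [|y _]; [right; exists 0 | rewrite partial_cst].
  by exists (fun=> (i == k)%:R) => [|y _]; [right; exists (i == k)%:R | rewrite partial_coord].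
Qed.

(** The derivatives of the coordinate functions are Kronecker symbols. *)
Lemma sum_coord f k y : \sum_i partial k (coord i) y * partial i f y = partial k f y.
Proof.
rewrite (bigD1 k) //= partial_coord eqxx mul1r big1 ?addr0 // => i ik.
by rewrite partial_coord (negPf ik) mul0r.
Qed.

Definition sinks_once L :=
  [&& size (incoming L 0) == 1, size (incoming L 1) == 1 & size (incoming L 2) == 1]%N.

(** A sink with exactly one incoming arrow is differentiated exactly once, so the
    operator is determined by its values on coordinate functions. *)
Lemma leibniz_coord L P T f g h y e : sinks_once L ->
  \sum_(i < n) \sum_(j < n) \sum_(k < n)
    leibniz_operator L P T (coord i) (coord j) (coord k) y *
      partial i f y * partial j g y * partial k h y =
  leibniz_operator L P T f g h y.
Proof.
move=> /and3P[]; case E0: (incoming L 0) => [|x0 []] // _.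
case E1: (incoming L 1) => [|x1 []] // _; case E2: (incoming L 2) => [|x2 []] // _.
pose K e := \prod_(p <- drop 3 (graph_factors L)) factor_val (content f g h P T) e p y.
have LE f1 g1 h1 : leibniz_operator L P T f1 g1 h1 y =
    sum_over (iota 0 9) (fun e => K e * (partial (e x0) f1 y * (partial (e x1) g1 y * partial (e x2) h1 y))) e.
  rewrite (leibniz_operatorE _ _ _ _ _ _ _ e); apply: eq_sum_over => e'.
  rewrite /factors_val /K /graph_factors E0 E1 E2 /= !big_cons !big_nil /factor_val /=.
  by rewrite [RHS]mulrC -!mulrA.
rewrite LE.
under eq_bigr => i _ do under eq_bigr => j _ do under eq_bigr => k _ do
  rewrite LE -!mulrA mulrC -sum_over_mulr.
under eq_bigr => i _ do under eq_bigr => j _ do rewrite -sum_over_sum.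
under eq_bigr => i _ do rewrite -sum_over_sum.
rewrite -sum_over_sum; apply: eq_sum_over => e'.
rewrite -(sum_coord f) -(sum_coord g) -(sum_coord h).
rewrite mulr_suml mulr_sumr; apply: eq_bigr => i _.
rewrite mulr_suml !mulr_sumr; apply: eq_bigr => j _.
rewrite !mulr_sumr; apply: eq_bigr => k _; ring.
Qed.

Lemma diamond_sinks_once : all (fun L => sinks_once L.1) diamond.
Proof. by vm_compute. Qed.

(** For arbitrary [P] and [T] the operator is thus a contraction of [f], [g], [h]
    with coefficients obtained from coordinate functions. *)
Lemma diamond_coord P T f g h y (e : env) :
  trivector_apply (fun i j k => diamond_operator P T (coord i) (coord j) (coord k)) f g h y =
  diamond_operator P T f g h y.
Proof.
rewrite /trivector_apply /diamond_operator.
under eq_bigr => i _ do under eq_bigr => j _ do under eq_bigr => k _ do rewrite !mulr_suml.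
under eq_bigr => i _ do under eq_bigr => j _ do rewrite exchange_big.
under eq_bigr => i _ do rewrite exchange_big.
rewrite exchange_big; apply: eq_big_seq => L /(allP diamond_sinks_once) sL.
rewrite -(leibniz_coord _ _ _ _ _ _ e sL) mulr_sumr; apply: eq_bigr => i _.
rewrite mulr_sumr; apply: eq_bigr => j _; rewrite mulr_sumr; apply: eq_bigr => k _.
by rewrite !mulrA.
Qed.

End diamond_operator_facts.

(** * Contractions under affine changes of coordinates *)

Section sums_of_products.
Context {R : comPzRingType} {n : nat}.
Notation env := (nat -> 'I_n).

(** The vertices use disjoint sets of arrows, so a product of sums, one per
    vertex, is a sum over all arrows. *)
Lemma sum_over_prod (I : Type) (r : seq I) (b : I -> seq nat) (F : I -> env -> R) e :
  (forall i, reads (b i) (F i)) -> uniq (flatten (map b r)) ->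
  \prod_(i <- r) sum_over (b i) (F i) e =
  sum_over (flatten (map b r)) (fun e => \prod_(i <- r) F i e) e.
Proof.
move=> rF; elim: r => [|i r IH] /=; first by rewrite !big_nil.
rewrite cat_uniq => /and3P[_ /hasPn dj u]; rewrite big_cons IH //.
have rr : reads (flatten (map b r)) (fun e => \prod_(i <- r) F i e).
  move=> e1 e2; elim: (r) => [|j s IHs] /= E; first by rewrite !big_nil.
  rewrite !big_cons; congr (_ * _); last by apply: IHs => x xs; apply: E; rewrite mem_cat xs orbT.
  by apply: rF => x xj; apply: E; rewrite mem_cat xj.
rewrite (sum_over_mul e (rF i) rr).
- by apply: eq_sum_over => e'; rewrite big_cons.
- by apply/allP => x xi; apply/negP => /dj /negP; apply.
- by apply/allP => x xi; apply: dj.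
Qed.
End sums_of_products.

Section affine_invariance.
Context {R : realType} {n : nat}.
Notation env := (nat -> 'I_n).
Notation fn := ('rV[R]_n -> R).
Variables (A : 'M[R]_n) (v : 'rV[R]_n) (V V' : set 'rV[R]_n).
Hypotheses (oV : open V) (oV' : open V').
Let phi (y : 'rV[R]_n) := y *m A + v.
Hypothesis phiV : forall y, V y -> V' (phi y).

Lemma partials_sum_over W bs (F : env -> fn) e s y : open W -> W y ->
  (forall e, smooth_on W (F e)) ->
  partials s (fun y => sum_over bs (fun e => F e y) e) y = sum_over bs (fun e => partials s (F e) y) e.
Proof.
move=> oW Wy sF; elim: bs e => //= x bs IH e.
rewrite (partials_sum _ _ oW Wy) => [|i]; last exact: smooth_sum_over.
by apply: eq_bigr => i _; apply: IH.
Qed.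

(** The chain rule for iterated partial derivatives: each derivative [k x] in the
    old coordinates is the combination of the derivatives [t x] in the new ones
    with coefficients [A (k x) (t x)]. *)
Lemma partials_affine (G : fn) (k : env) ins y e : uniq ins -> smooth_on V' G -> V y ->
  partials (map k ins) (G \o phi) y =
  sum_over ins (fun t => \prod_(x <- ins) A (k x) (t x) * partials (map t ins) G (phi y)) e.
Proof.
move=> + sG; elim: ins y e => [|x s IH] y e /=; first by rewrite big_nil mul1r.
move=> /andP[xs us] Vy.
pose F (t : env) : fn := fun z => (\prod_(x <- s) A (k x) (t x)) * partials (map t s) G (phi z).
have sF t : smooth_on V (F t).
  apply: smooth_onM oV _ _; first exact: smooth_on_cst.
  by apply: (smooth_on_affine oV oV' phiV); apply: smooth_on_partials.
rewrite (partial_eq_on _ oV Vy (fun z Vz => IH z e us Vz)).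
rewrite (partial_sum_over oV s e _ Vy sF).
transitivity (\sum_i sum_over s (fun t => A (k x) i * ((\prod_(x <- s) A (k x) (t x)) *
     partial i (partials (map t s) G) (phi y))) e).
  rewrite -sum_over_sum; apply: eq_sum_over => t.
  have sp : smooth_on V' (partials (map t s) G) by apply: smooth_on_partials.
  rewrite (partialZ _ _ (smooth_on_affine oV oV' phiV sp) Vy).
  rewrite (partial_affine oV' phiV _ Vy sp) mulr_sumr; apply: eq_bigr => i _; exact: mulrCA.
apply: eq_bigr => i _.
transitivity (sum_over s (fun t => A (k x) i * ((\prod_(x <- s) A (k x) (t x)) *
     partial i (partials (map t s) G) (phi y))) (update e x i)).
  apply: (@sum_over_env _ _ s) => [e1 e2 E|z ->] //.
  rewrite (iffLR (eq_in_map _ _ _) E); congr (_ * (_ * _)).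
  by apply: eq_big_seq => z /E ->.
apply: (eq_sum_over_fixed xs) => t; rewrite /update eqxx => tx.
by rewrite big_cons tx mulrA.
Qed.

Variables (Cb Ca : nat -> seq 'I_n -> fn) (G : nat -> seq 'I_n -> fn) (fs : seq factor).
Hypothesis sG : forall l o, smooth_on V' (G l o).
Hypothesis CaE : forall l o y, V y -> Ca l o y = G l o (phi y).
Hypothesis CbE : forall p e o z, p \in fs -> V' z -> Cb p.1 (map o p.2.1) z =
  sum_over p.2.1 (fun k : env => \prod_(x <- p.2.1) A (k x) (o x) * G p.1 (map k p.2.1) z) e.

(** A full contraction is invariant under affine changes of coordinates. In the new
    coordinates every arrow carries one factor of [A], produced by the tensor it
    leaves; in the old ones it carries the same factor, produced by the chain
    rule at the vertex it enters. The functions [G] are the components in the old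
    frame, seen as functions of the new coordinates; both sides are the same
    double sum over the old and the new indices, taken in opposite orders. *)
Lemma contraction_affine N e y : V y -> uniq N ->
  perm_eq (flatten [seq p.2.1 | p : factor <- fs]) N ->
  perm_eq (flatten [seq p.2.2 | p : factor <- fs]) N ->
  sum_over N (fun o => factors_val Cb o fs (phi y)) e = sum_over N (fun k => factors_val Ca k fs y) e.
Proof.
move=> Vy uN po pi.
(* A vertex with the derivatives [t] in the new frame and the components [k] in
   the old one. *)
pose mix (t k : env) (p : factor) := partials (map t p.2.2) (G p.1 (map k p.2.1)) (phi y).
pose w (k t : env) : R := \prod_(x <- N) A (k x) (t x).
have rmix t : reads (flatten [seq p.2.1 | p : factor <- fs]) (fun k => \prod_(p <- fs) mix t k p).
  move=> k1 k2 E; apply: eq_big_seq => p pfs; rewrite /mix; congr (partials _ (G _ _) _).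
  by apply/eq_in_map => x xp; apply: E; apply/flatten_mapP; exists p.
have rmix' k : reads (flatten [seq p.2.2 | p : factor <- fs]) (fun t => \prod_(p <- fs) mix t k p).
  move=> k1 k2 E; apply: eq_big_seq => p pfs; rewrite /mix; congr (partials _ (G _ _) _).
  by apply/eq_in_map => x xp; apply: E; apply/flatten_mapP; exists p.
have rw t : reads N (fun k => w k t).
  by move=> k1 k2 E; apply: eq_big_seq => x /E ->.
have rw' k : reads N (w k).
  by move=> k1 k2 E; apply: eq_big_seq => x /E ->.
have uo : uniq (flatten [seq p.2.1 | p : factor <- fs]) by rewrite (perm_uniq po).
have ui : uniq (flatten [seq p.2.2 | p : factor <- fs]) by rewrite (perm_uniq pi).
have Eb o : factors_val Cb o fs (phi y) = sum_over N (fun k => w k o * \prod_(p <- fs) mix o k p) e.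
  rewrite /factors_val.
  transitivity (\prod_(p <- fs) sum_over p.2.1 (fun k => \prod_(x <- p.2.1) A (k x) (o x) * mix o k p) e).
    apply: eq_big_seq => p pfs; rewrite /factor_val.
    rewrite (partials_eq_on _ oV' (phiV Vy) (fun z Vz => CbE e o pfs Vz)).
    rewrite (partials_sum_over _ _ _ oV' (phiV Vy)) => [|k]; last first.
      by apply: smooth_onM oV' _ _; [exact: smooth_on_cst | exact: sG].
    by apply: eq_sum_over => k; rewrite (partialsZ _ _ oV' _ (phiV Vy)).
  rewrite sum_over_prod //; last first.
    move=> p k1 k2 E; rewrite /mix (iffLR (eq_in_map _ _ _) E); congr (_ * _).
    by apply: eq_big_seq => x /E ->.
  rewrite (@sum_over_perm _ _ (flatten [seq p.2.1 | p : factor <- fs]) _ _ _ e _ uo po); last first.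
    move=> k1 k2 E; rewrite !big_split /=; congr (_ * _); last exact: rmix.
    apply: eq_big_seq => p pfs; apply: eq_big_seq => x xp; rewrite E //.
    by apply/flatten_mapP; exists p.
  apply: eq_sum_over => k; rewrite big_split /=; congr (_ * _).
  by rewrite /w -(perm_big _ po) big_flatten big_map.
have Ea k : factors_val Ca k fs y = sum_over N (fun t => w k t * \prod_(p <- fs) mix t k p) e.
  rewrite /factors_val.
  transitivity (\prod_(p <- fs) sum_over p.2.2 (fun t => \prod_(x <- p.2.2) A (k x) (t x) * mix t k p) e).
    apply: eq_big_seq => p pfs; rewrite /factor_val.
    rewrite (partials_eq_on _ oV Vy (fun z Vz => CaE _ _ Vz)).
    apply: partials_affine => //.
    have : subseq p.2.2 (flatten [seq p.2.2 | p : factor <- fs]).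
      case/splitPr: pfs => s1 s2; rewrite map_cat flatten_cat /=.
      exact: subseq_trans (prefix_subseq _ _) (suffix_subseq _ _).
    by move/subseq_uniq; apply.
  rewrite sum_over_prod //; last first.
    move=> p k1 k2 E; rewrite /mix (iffLR (eq_in_map _ _ _) E); congr (_ * _).
    by apply: eq_big_seq => x /E ->.
  rewrite (@sum_over_perm _ _ (flatten [seq p.2.2 | p : factor <- fs]) _ _ _ e _ ui pi); last first.
    move=> k1 k2 E; rewrite !big_split /=; congr (_ * _); last exact: rmix'.
    apply: eq_big_seq => p pfs; apply: eq_big_seq => x xp; rewrite E //.
    by apply/flatten_mapP; exists p.
  apply: eq_sum_over => t; rewrite big_split /=; congr (_ * _).
  by rewrite /w -(perm_big _ pi) big_flatten big_map.
rewrite (eq_sum_over _ _ Eb) (eq_sum_over _ _ Ea).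
exact: sum_over_exchange.
Qed.

End affine_invariance.

(** * Antisymmetry, covariance and differential polynomials *)

Section diamond_is_trivector.
Context {R : realType} {n : nat}.
Notation env := (nat -> 'I_n).
Notation fn := ('rV[R]_n -> R).
Implicit Types (e : env) (y : 'rV[R]_n) (f g h : fn) (P : 'I_n -> 'I_n -> fn)
  (T : 'I_n -> 'I_n -> 'I_n -> fn) (V : set 'rV[R]_n).

(** The antisymmetry of the operator holds for any trivector, not just for the
    Jacobiator; it is checked on the graphs. Two transpositions generate all
    permutations of the three sinks. *)
Lemma diamond_swap01 : vanishes (Add (diamond_expr (sink 0) (sink 1) (sink 2) bivec trivec)
                                     (diamond_expr (sink 1) (sink 0) (sink 2) bivec trivec)).
Proof. by vm_compute. Qed.

Lemma diamond_swap12 : vanishes (Add (diamond_expr (sink 0) (sink 1) (sink 2) bivec trivec)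
                                     (diamond_expr (sink 0) (sink 2) (sink 1) bivec trivec)).
Proof. by vm_compute. Qed.

Lemma diamond_skew V P T f g h y (e : env) : open V -> V y ->
  (forall i j, smooth_on V (P i j)) -> (forall i j k, smooth_on V (T i j k)) ->
  smooth_on V f -> smooth_on V g -> smooth_on V h ->
  (forall i j y, V y -> P i j y = - P j i y) ->
  (forall i j k y, V y -> T i j k y = - T j i k y /\ T i j k y = - T i k j y) ->
  diamond_operator P T f g h y = - diamond_operator P T g f h y /\
  diamond_operator P T f g h y = - diamond_operator P T f h g y.
Proof.
move=> oV Vy sP sT sf sg sh skP skT.
have sC := smooth_content sf sg sh sP sT; have skC := skew_content f g h skP skT.
have := vanishes_sound oV sC skC e diamond_swap01 Vy.
have := vanishes_sound oV sC skC e diamond_swap12 Vy.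
cbn [denote]; rewrite !(denote_diamond (U := trivec) (F := sink 0) (G := sink 1) (P := P) (T := T) (f := f) (g := g) (h := h)) //.
rewrite (denote_diamond (P := P) (T := T) (f := f) (g := h) (h := g)) //.
rewrite (denote_diamond (P := P) (T := T) (f := g) (g := f) (h := h)) //.
by move=> /eqP; rewrite addr_eq0 => /eqP -> /eqP; rewrite addr_eq0 => /eqP ->.
Qed.

(** What makes a graph a full contraction, hence insensitive to a change of frame. *)
Definition balanced L :=
  perm_eq (flatten [seq p.2.1 | p : factor <- graph_factors L]) (iota 0 9) &&
  perm_eq (flatten [seq p.2.2 | p : factor <- graph_factors L]) (iota 0 9).

Lemma diamond_balanced : all (fun L => balanced L.1) diamond.
Proof. by vm_compute. Qed.

(** [P] and [T] are the components of the tensors in the old frame, as functions of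
    the new coordinates. *)
Lemma diamond_affine (A : 'M[R]_n) (v : 'rV[R]_n) V V' Pb Tb Pa Ta P T f g h y (e : env) :
  let phi z := z *m A + v in
  open V -> open V' -> V y -> (forall z, V z -> V' (phi z)) ->
  (forall i j, smooth_on V' (P i j)) -> (forall i j k, smooth_on V' (T i j k)) ->
  smooth_on V' f -> smooth_on V' g -> smooth_on V' h ->
  (forall i j z, V z -> Pa i j z = P i j (phi z)) ->
  (forall i j k z, V z -> Ta i j k z = T i j k (phi z)) ->
  (forall i j z, V' z -> Pb i j z = \sum_(k < n) \sum_(l < n) A k i * A l j * P k l z) ->
  (forall i j k z, V' z -> Tb i j k z =
    \sum_(p < n) \sum_(q < n) \sum_(r < n) A p i * A q j * A r k * T p q r z) ->
  diamond_operator Pb Tb f g h (phi y) =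
  diamond_operator Pa Ta (f \o phi) (g \o phi) (h \o phi) y.
Proof.
move=> phi oV oV' Vy phiV sP sT sf sg sh PaE TaE PbE TbE.
rewrite /diamond_operator; apply: eq_big_seq => L /(allP diamond_balanced) /andP[bo bi].
congr (_ * _); rewrite !(leibniz_operatorE _ _ _ _ _ _ _ e).
apply: (contraction_affine oV oV' phiV (smooth_content sf sg sh sP sT)) => //.
- move=> l o z Vz.
  case: l => [|[|[|[|[|l]]]]] //=.
  + by case: o.
  + by case: o.
  + by case: o.
  + by case: o => [|i [|j [|? ?]]] //=; apply: PaE.
  + by case: o => [|i [|j [|k [|? ?]]]] //=; apply: TaE.
- move=> p e' o z + V'z; rewrite !inE.
  do 3![case/predU1P => [->|]; first by rewrite /= big_nil mul1r].
  do 3![case/predU1P => [->|]; first by rewrite /= PbE //;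
    do 2![apply: eq_bigr => ? _]; rewrite !big_cons big_nil /= mulr1].
  move/eqP->; rewrite /= TbE //.
  by do 3![apply: eq_bigr => ? _]; rewrite !big_cons big_nil /= mulr1 !mulrA.
Qed.

(** The form required of a polydifferential operator in one chart. A list of
    monomials, rather than an indexed family, makes closure under sums
    immediate. *)
Definition jet_polynomial V (d r : nat) (F : ('I_n -> 'I_n -> fn) -> ('I_n -> 'I_n -> 'I_n -> fn) -> fn) :=
  exists ms : seq (@diff_monomial R n),
    all (fun m => `[< smooth_on V (dm_coef m) /\ dm_bounded d r m >]) ms /\
    forall P T y, F P T y = \sum_(m <- ms) dm_eval m P T y.

Lemma jet_polynomial_sum V d r (I : eqType) (s : seq I) F :
  (forall i, i \in s -> jet_polynomial V d r (F i)) ->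
  jet_polynomial V d r (fun P T y => \sum_(i <- s) F i P T y).
Proof.
elim: s => [|i s IH] js.
  by exists [::]; split=> // P T y; rewrite !big_nil.
have [ms [okm E]] := js i (mem_head _ _).
have [|ms' [okm' E']] := IH; first by move=> j js'; apply: js; rewrite inE js' orbT.
exists (ms ++ ms'); split=> [|P T y]; first by rewrite all_cat okm.
by rewrite big_cons big_cat E E'.
Qed.

Lemma jet_polynomialZ V d r (c : R) F : open V -> jet_polynomial V d r F ->
  jet_polynomial V d r (fun P T y => c * F P T y).
Proof.
move=> oV [ms [okm E]].
exists [seq DiffMonomial (fun y => c * dm_coef m y) (dm_bivector m) (dm_trivector m) | m <- ms].
split=> [|P T y]; last first.
  rewrite E mulr_sumr big_map; apply: eq_bigr => m _.
  by rewrite /dm_eval /=; case: (dm_trivector m) => s [[i j] k]; rewrite !mulrA.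
rewrite all_map; apply: sub_all okm => m /asboolP[sm bm]; apply/asboolP; split; last exact: bm.
by apply: smooth_onM oV _ sm; apply: smooth_on_cst.
Qed.

Lemma jet_polynomial_sum_over V d r bs (F : env -> _) e :
  (forall e, jet_polynomial V d r (F e)) ->
  jet_polynomial V d r (fun P T y => sum_over bs (fun e => F e P T y) e).
Proof.
move=> jF; elim: bs e => [|x bs IH] e /=; first exact: jF.
by apply: jet_polynomial_sum.
Qed.

(** For each assignment of the indices the graph is one monomial, of degree three
    in the bivector. The arrows into the sinks only contribute to its
    coefficient, and a vertex receives at most the nine arrows of the graph. *)
Lemma jet_polynomial_leibniz V L f g h e : open V ->
  smooth_on V f -> smooth_on V g -> smooth_on V h ->
  jet_polynomial V 3 9 (fun P T y => leibniz_operator L P T f g h y).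
Proof.
move=> oV sf sg sh.
have szi k : (size (incoming L k) <= 9)%N.
  rewrite size_map; apply: leq_trans (_ : size (arrows L) <= 9)%N.
    by rewrite size_filter count_size.
  by case: (L) => [[[[? ?] [? ?]] [? ?]] [[? ?] ?]].
have [|ms [okm E]] := @jet_polynomial_sum_over V 3 9 (iota 0 9)
  (fun e P T y => factors_val (content f g h P T) e (graph_factors L) y) e; last first.
  by exists ms; split=> // P T y; rewrite (leibniz_operatorE _ _ _ _ _ _ _ e).
move=> e'; pose w k := map e' (incoming L k).
exists [:: DiffMonomial (fun y => partials (w 0%N) f y * partials (w 1%N) g y * partials (w 2%N) h y)
   [:: (w 3%N, (e' 0%N, e' 1%N)); (w 4%N, (e' 2%N, e' 3%N)); (w 5%N, (e' 4%N, e' 5%N))]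
   (w 6%N, (e' 6%N, e' 7%N, e' 8%N))].
split=> [|P T y]; last first.
  by rewrite big_seq1 /dm_eval /factors_val prod7 /factor_val /= !big_cons big_nil mulr1 /= !mulrA.
rewrite all_seq1; apply/asboolP; split=> /=.
  have sw k (f0 : fn) : smooth_on V f0 -> smooth_on V (partials (w k) f0).
    exact: smooth_on_partials.
  exact: (smooth_onM oV (smooth_onM oV (sw _ _ sf) (sw _ _ sg)) (sw _ _ sh)).
have szw k : (size (w k) <= 9)%N by rewrite size_map szi.
by split; [| apply/and4P; split; rewrite ?szw | exact: szw].
Qed.

Lemma jet_polynomial_diamond V f g h e : open V ->
  smooth_on V f -> smooth_on V g -> smooth_on V h ->
  jet_polynomial V 3 9 (fun P T y => diamond_operator P T f g h y).
Proof.
move=> oV sf sg sh; apply: jet_polynomial_sum => L _.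
by apply: jet_polynomialZ => //; apply: jet_polynomial_leibniz.
Qed.

End diamond_is_trivector.

(** * The factorization identity *)

Section factorization.
Context {R : realType} {n : nat}.
Notation env := (nat -> 'I_n).
Notation fn := ('rV[R]_n -> R).
Implicit Types (e : env) (y : 'rV[R]_n) (f g h : fn) (P Q : 'I_n -> 'I_n -> fn) (V : set 'rV[R]_n).

(** The core of the theorem, as an identity between integral combinations of
    graphs with five bivectors. *)
Lemma factorization_vanishes : vanishes (Add (schouten_expr bivec (flow_expr bivec) (sink 0) (sink 1) (sink 2))
   (Scale (-4)%R (diamond_expr (sink 0) (sink 1) (sink 2) bivec (jac_expr 9 bivec)))).
Proof. by vm_compute. Qed.

(** The flow has coefficients [1/4] and [3/2]; the normal forms have integer
    coefficients. *)
Definition four_flow P (i j : 'I_n) : fn := fun y => Gamma1 P i j y + 6 * Gamma2 P i j y.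

Lemma bivector_applyZ (c : R) Q f g :
  bivector_apply (fun i j y => c * Q i j y) f g = fun y => c * bivector_apply Q f g y.
Proof.
apply/funext => y; rewrite /bivector_apply mulr_sumr; apply: eq_bigr => i _.
by rewrite mulr_sumr; apply: eq_bigr => j _; rewrite !mulrA.
Qed.

Lemma bivector_apply_scaled V (c : R) P f g y : V y -> smooth_on V f ->
  bivector_apply P (fun y => c * f y) g y = c * bivector_apply P f g y.
Proof.
move=> Vy sf; rewrite /bivector_apply mulr_sumr; apply: eq_bigr => i _.
rewrite mulr_sumr; apply: eq_bigr => j _; rewrite !(partialZ _ _ sf Vy).
by rewrite mulrCA -!mulrA -mulrBr.
Qed.

Lemma schouten_scaled V (c : R) P Q f g h y : V y ->
  smooth_on V (bivector_apply Q f g) -> smooth_on V (bivector_apply Q g h) ->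
  smooth_on V (bivector_apply Q h f) ->
  schouten P (fun i j y => c * Q i j y) f g h y = c * schouten P Q f g h y.
Proof.
move=> Vy s1 s2 s3; rewrite /schouten !bivector_applyZ.
rewrite (bivector_apply_scaled c P h Vy s1) (bivector_apply_scaled c P f Vy s2).
by rewrite (bivector_apply_scaled c P g Vy s3) -!mulrDr.
Qed.

Lemma denote_biv (C : nat -> seq 'I_n -> fn) x z A F G Q f g e : x != z ->
  (forall e, denote C (A x z) e = Q (e x) (e z)) ->
  (forall e, denote C F e = f) -> (forall e, denote C G e = g) ->
  denote C (biv_expr x z A F G) e = bivector_apply Q f g.
Proof.
move=> xz dA dF dG; apply/funext => y /=; rewrite /bivector_apply.
apply: eq_bigr => i _; apply: eq_bigr => j _.
by rewrite dA !dF !dG /update !eqxx (negPf xz) mulN1r.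
Qed.

(** The names [0], [1] index the outer bracket and [2], [3] the inner one; the
    hypotheses on [A] and [B] are only required at these names. *)
Lemma denote_schouten (C : nat -> seq 'I_n -> fn) A B F G H P Q f g h e y :
  (forall e, denote C (A 0%N 1%N) e = P (e 0%N) (e 1%N)) ->
  (forall e, denote C (A 2%N 3%N) e = P (e 2%N) (e 3%N)) ->
  (forall e, denote C (B 0%N 1%N) e = Q (e 0%N) (e 1%N)) ->
  (forall e, denote C (B 2%N 3%N) e = Q (e 2%N) (e 3%N)) ->
  (forall e, denote C F e = f) -> (forall e, denote C G e = g) -> (forall e, denote C H e = h) ->
  denote C (schouten_expr A B F G H) e y = schouten P Q f g h y.
Proof.
move=> A01 A23 B01 B23 dF dG dH; rewrite /schouten /schouten_expr.
have dterm X Y Z x w z (dX : forall e, denote C X e = x) (dY : forall e, denote C Y e = w)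
    (dZ : forall e, denote C Z e = z) e' :
  denote C (Add (biv_expr 0 1 A (biv_expr 2 3 B X Y) Z) (biv_expr 0 1 B (biv_expr 2 3 A X Y) Z)) e' y =
  bivector_apply P (bivector_apply Q x w) z y + bivector_apply Q (bivector_apply P x w) z y.
  cbn [denote]; congr (_ + _).
    by rewrite (denote_biv (Q := P) (f := bivector_apply Q x w) (g := z)) // => e1; apply: denote_biv.
  by rewrite (denote_biv (Q := Q) (f := bivector_apply P x w) (g := z)) // => e1; apply: denote_biv.
cbn [denote]; congr (_ + _ + _).
- exact: (dterm _ _ _ _ _ _ dF dG dH).
- exact: (dterm _ _ _ _ _ _ dG dH dF).
- exact: (dterm _ _ _ _ _ _ dH dF dG).
Qed.

Lemma update_iota e (x : nat) i4 i5 i6 i7 i8 i9 : x \notin iota 4 6 ->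
  update (update (update (update (update (update e 4 i4) 5 i5) 6 i6) 7 i7) 8 i8) 9 i9 x = e x.
Proof.
rewrite /= !inE !negb_or => /and5P[x4 x5 x6 x7 /andP[x8 x9]].
by rewrite /update (negPf x4) (negPf x5) (negPf x6) (negPf x7) (negPf x8) (negPf x9).
Qed.

Lemma denote_gamma1 f g h P T (x z : nat) e y : x \notin iota 4 6 -> z \notin iota 4 6 ->
  denote (content f g h P T) (gamma1_expr bivec x z) e y = Gamma1 P (e x) (e z) y.
Proof.
move=> xN zN; rewrite denote_sums /Gamma1 [iota 4 6]/=; cbn [sum_over].
apply: eq_bigr => i4 _; apply: eq_bigr => i5 _; apply: eq_bigr => i6 _.
apply: eq_bigr => i7 _; apply: eq_bigr => i8 _; apply: eq_bigr => i9 _.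
by rewrite -(update_iota e i4 i5 i6 i7 i8 i9 xN) -(update_iota e i4 i5 i6 i7 i8 i9 zN).
Qed.

Lemma denote_gamma2 f g h P T (x z : nat) e y : x \notin iota 4 6 -> z \notin iota 4 6 ->
  denote (content f g h P T) (gamma2_expr bivec x z) e y = Gamma2 P (e x) (e z) y.
Proof.
move=> xN zN; rewrite denote_sums /Gamma2 [iota 4 6]/=; cbn [sum_over].
apply: eq_bigr => i4 _; apply: eq_bigr => i5 _; apply: eq_bigr => i6 _.
apply: eq_bigr => i7 _; apply: eq_bigr => i8 _; apply: eq_bigr => i9 _.
by rewrite -(update_iota e i4 i5 i6 i7 i8 i9 xN) -(update_iota e i4 i5 i6 i7 i8 i9 zN).
Qed.

Lemma denote_flow f g h P T (x z : nat) e : x \notin iota 4 6 -> z \notin iota 4 6 ->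
  denote (content f g h P T) (flow_expr bivec x z) e = four_flow P (e x) (e z).
Proof.
move=> xN zN; apply/funext => y; rewrite /four_flow /flow_expr.
by cbn [denote]; rewrite (denote_gamma1 _ _ _ _ _ _ _ xN zN) (denote_gamma2 _ _ _ _ _ _ _ xN zN).
Qed.

Lemma denote_jac f g h P T (a b c : nat) e : a != 9%N -> b != 9%N -> c != 9%N ->
  denote (content f g h P T) (jac_expr 9 bivec a b c) e = jacobiator P (e a) (e b) (e c).
Proof.
move=> a9 b9 c9; apply/funext => y.
rewrite /jac_expr /jacobiator.
cbn [denote].
apply: eq_bigr => s _.
have E x : x != 9%N -> e x = update e 9 s x by rewrite /update => /negPf ->.
by rewrite (E a) // (E b) // (E c).
Qed.

(** The combination of graphs above contains four times the operator, since the
    flow has been multiplied by four. *)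
Theorem schouten_flow V P f g h y (e : env) : open V -> V y ->
  (forall i j, smooth_on V (P i j)) ->
  smooth_on V f -> smooth_on V g -> smooth_on V h ->
  (forall i j y, V y -> P i j y = - P j i y) ->
  schouten P (tetrahedral_flow P) f g h y = diamond_operator P (jacobiator P) f g h y.
Proof.
move=> oV Vy sP sf sg sh skP.
(* No vertex carries a trivector here: the Jacobiator has been expanded. *)
pose T0 (i j k : 'I_n) : fn := fun=> 0.
pose C := content f g h P T0.
have sC : forall l o, smooth_on V (C l o).
  have sT0 (i j k : 'I_n) : smooth_on V (T0 i j k) by exact: (@smooth_on_cst R n V 0).
  exact: (smooth_content sf sg sh sP sT0).
have skC : forall l o1 a b o2 y, V y -> C l (o1 ++ a :: b :: o2) y = - C l (o1 ++ b :: a :: o2) y.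
  by apply: skew_content skP _ => i j k z _; rewrite oppr0.
have -> : tetrahedral_flow P = fun i j z => 4^-1 * four_flow P i j z.
  apply/funext=> i; apply/funext=> j; apply/funext=> z; rewrite /tetrahedral_flow /four_flow.
  by field.
have sQ f1 f2 l1 l2 : C l1 [::] = f1 -> C l2 [::] = f2 -> smooth_on V (bivector_apply (four_flow P) f1 f2).
  move=> E1 E2; have := smooth_denote oV sC (biv_expr 0 1 (flow_expr bivec) (sink l1) (sink l2)) e.
  by rewrite (denote_biv (Q := four_flow P) (f := f1) (g := f2)) // => e1; apply: denote_flow.
rewrite (schouten_scaled _ _ Vy); last 3 first.
- exact: (sQ _ _ 0%N 1%N).
- exact: (sQ _ _ 1%N 2%N).
- exact: (sQ _ _ 2%N 0%N).
have D : denote C (diamond_expr (sink 0) (sink 1) (sink 2) bivec (jac_expr 9 bivec)) e y =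
    diamond_operator P (jacobiator P) f g h y.
  apply: denote_diamond; [by []|by []|by []|by []|move=> e'; exact: denote_jac].
have S : denote C (schouten_expr bivec (flow_expr bivec) (sink 0) (sink 1) (sink 2)) e y =
    schouten P (four_flow P) f g h y.
  apply: denote_schouten; [by []|by []| | |by []|by []|by []]; move=> e'; exact: denote_flow.
have := vanishes_sound oV sC skC e factorization_vanishes Vy.
cbn [denote]; rewrite D S.
move=> /eqP; rewrite addr_eq0 => /eqP ->.
rewrite -mulNr mulrA mulrNz opprK mulVf ?mul1r //.
Qed.

End factorization.

(** * Charts and coordinate changes *)

Section charts.
Context {R : realType} {n : nat}.
Variable N : affine_manifold R n.
Implicit Types (a b : chart N) (x : N).

(** The chart is a homeomorphism onto its image. *)
Lemma open_chart_image a (W : set N) : open W -> open (chart_map a @` (W `&` chart_dom a)).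
Proof.
move=> oW; rewrite openE => _ [x [Wx ax] <-].
have ix : (chart_map a @` chart_dom a) (chart_map a x) by exists x.
have nW : \forall z \near chart_map a x, W (chart_inv a z).
  apply: (affm_inv_cont ix); rewrite affm_mapK //; exact: open_nbhs_nbhs.
have nI := open_nbhs_nbhs (conj (@affm_open_img _ _ N a) ix).
apply: filterS2 nW nI => z Wz [x' ax' zE]; exists x' => //; split=> //.
by rewrite -(affm_mapK ax') zE.
Qed.

Arguments open_chart_image a {W} _.

(** Both coordinate changes are affine on a common neighbourhood. Having both
    directions at hand avoids inverting the matrix [A]. *)
Lemma affine_transition a b x : chart_dom a x -> chart_dom b x ->
  exists (A : 'M[R]_n) (v : 'rV[R]_n) (B : 'M[R]_n) (w : 'rV[R]_n) (U : set N),
  [/\ open U, U x, forall z, U z -> chart_dom a z /\ chart_dom b z,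
      forall z, U z -> chart_map b z = chart_map a z *m A + v &
      forall z, U z -> chart_map a z = chart_map b z *m B + w].
Proof.
move=> ax bx; have [A [v Av]] := affm_affine ax bx; have [B [w Bw]] := affm_affine bx ax.
have na := open_nbhs_nbhs (conj (@affm_open_dom _ _ N a) ax).
have nb := open_nbhs_nbhs (conj (@affm_open_dom _ _ N b) bx).
have := filterI (filterI na nb) (filterI Av Bw).
set S := (X in nbhs x X) => nS; exists A, v, B, w, (interior S).
have UP : interior S `<=` S by exact: interior_subset.
split.
- exact: open_interior.
- exact: nS.
- by move=> z /UP[[]].
- by move=> z /UP[_ []].
- by move=> z /UP[_ []].
Qed.

(** The derivative is characterized by a Landau remainder, and here the remainder
    vanishes near the point. *)
Lemma jacobian_affine (f : 'rV[R]_n -> 'rV[R]_n) (A : 'M[R]_n) (v y : 'rV[R]_n) :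
  (\forall z \near y, f z = z *m A + v) -> jacobian f y = A.
Proof.
move=> fE; rewrite /jacobian.
have cA : continuous (mulmxr A : 'rV[R]_n -> 'rV[R]_n).
  have <- : (fun z => z *m A + 0) = mulmxr A :> ('rV[R]_n -> 'rV[R]_n).
    by apply/funext=> z; rewrite addr0.
  exact: affine_continuous.
have -> : 'd f y = mulmxr A :> ('rV[R]_n -> 'rV[R]_n).
  apply: diff_unique => //; apply/eqaddoP => eps eps0.
  have : \forall h \near (0 : 'rV[R]_n), f (h + y) = (h + y) *m A + v.
    have := fE; rewrite (near_shift 0 y) /=.
    by apply: filterS => h /=; rewrite subr0.
  apply: filterS => h E.
  rewrite !fctE /= E (nbhs_singleton fE) mulmxDl.
  have -> : h *m A + y *m A + v - (y *m A + v + h *m A) = 0.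
    by apply/eqP; rewrite subr_eq0 -addrA addrC.
  by rewrite normr0 mulr_ge0 // ltW.
by apply/matrixP=> i j; rewrite [LHS]mxE /= -rowE mxE.
Qed.

Lemma transition_jac_affine a b x (A : 'M[R]_n) v (U : set N) : open U -> U x ->
  (forall z, U z -> chart_dom a z /\ chart_dom b z) ->
  (forall z, U z -> chart_map b z = chart_map a z *m A + v) ->
  transition_jac a b x = A.
Proof.
move=> oU Ux Uab UA; apply: (@jacobian_affine _ A v).
have oaU := open_chart_image a oU.
have ax : (chart_map a @` (U `&` chart_dom a)) (chart_map a x).
  by exists x => //; split=> //; case: (Uab x Ux).
apply: filterS (open_nbhs_nbhs (conj oaU ax)) => _ [z [Uz az] <-] /=.
by rewrite affm_mapK // UA.
Qed.

(** The coefficients of a trivector are its values on the coordinate functions of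
    the chart; this turns the sum of graphs into a trivector. *)
Definition diamond_coefs (P : bivector_coefs N) (T : trivector_coefs N) : trivector_coefs N :=
  fun a i j k => diamond_operator (P a) (T a) (coord i) (coord j) (coord k).

Lemma open_chart_img a : open (chart_img a).
Proof. exact: affm_open_img. Qed.

Arguments open_chart_img : clear implicits.

(** Smoothness and antisymmetry are local. For the transformation law, the
    coordinates of the second chart are affine functions of those of the first
    one; the operator is invariant by [diamond_affine], and [diamond_coord]
    expands it in the coordinates of the first chart. *)
Lemma diamond_trivector_field (e : nat -> 'I_n) P T :
  bivector_field P -> trivector_field T -> trivector_field (diamond_coefs P T).
Proof.
move=> [sP skP trP] [sT skT trT].
have skP' a i j y : chart_img a y -> P a i j y = - P a j i y by exact: skP.
split=> [a i j k|a i j k y ay|a b x i j k ax bx].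
- by apply: (smooth_diamond (open_chart_img a)) => //; apply: smooth_coord; apply: open_chart_img.
- have sc l : smooth_on (chart_img a) (coord l : 'rV[R]_n -> R).
    by apply: smooth_coord; apply: open_chart_img.
  exact: (diamond_skew e (open_chart_img a) ay (sP a) (sT a) (sc i) (sc j) (sc k)
    (fun i j y => @skP' a i j y) (skT a)).
have [A [v [B [w [U [oU Ux Uab UA UB]]]]]] := affine_transition ax bx.
have jac z : U z -> transition_jac a b z = A.
  by move=> Uz; apply: transition_jac_affine oU Uz Uab UA.
pose V : set 'rV[R]_n := chart_map a @` U; pose V' : set 'rV[R]_n := chart_map b @` U.
have UI c : (forall z, U z -> chart_dom c z) -> U `&` chart_dom c = U.
  by move=> Uc; apply/seteqP; split=> [z []|z Uz] //; split=> //; apply: Uc.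
have oV : open V.
  by rewrite /V -(UI a) => [|z /Uab[]] //; apply: open_chart_image.
have oV' : open V'.
  by rewrite /V' -(UI b) => [|z /Uab[]] //; apply: open_chart_image.
pose phi z := z *m A + v; pose psi z := z *m B + w.
have phiV z : V z -> V' (phi z) by move=> [u Uu <-]; exists u => //; rewrite UA.
have psiV z : V' z -> V (psi z) by move=> [u Uu <-]; exists u => //; rewrite UB.
have psiK z : V z -> psi (phi z) = z.
  by move=> [u Uu <-]; rewrite /phi -UA // /psi -UB.
have Va : V `<=` chart_img a by move=> _ [u /Uab[au _] <-]; exists u.
have sc l : smooth_on V' (coord l : 'rV[R]_n -> R) by apply: smooth_coord.
have Vx : V (chart_map a x) by exists x.
have sPpsi p q : smooth_on V' (P a p q \o psi).
  by apply: (smooth_on_affine oV' oV psiV); apply: smooth_on_sub Va _; apply: sP.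
have sTpsi p q r : smooth_on V' (T a p q r \o psi).
  by apply: (smooth_on_affine oV' oV psiV); apply: smooth_on_sub Va _; apply: sT.
have PaE p q z : V z -> P a p q z = (P a p q \o psi) (phi z) by move=> /psiK /= ->.
have TaE p q r z : V z -> T a p q r z = (T a p q r \o psi) (phi z) by move=> /psiK /= ->.
have PbE p q z : V' z -> P b p q z =
    \sum_(k < n) \sum_(l < n) A k p * A l q * (P a k l \o psi) z.
  move=> [u Uu <-]; have [au bu] := Uab u Uu.
  by rewrite (trP a b u) // jac //= /psi -UB.
have TbE p q r z : V' z -> T b p q r z =
    \sum_(k < n) \sum_(l < n) \sum_(m < n) A k p * A l q * A m r * (T a k l m \o psi) z.
  move=> [u Uu <-]; have [au bu] := Uab u Uu.
  by rewrite (trT a b u) // jac //= /psi -UB.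
(* The coordinates of the second chart have the columns of [A] as gradients. *)
have pc l p : partial p (coord l \o phi) (chart_map a x) = A p l.
  rewrite (partial_affine oV' phiV _ Vx (sc l)) (bigD1 l) //= partial_coord eqxx mulr1.
  by rewrite big1 ?addr0 // => q ql; rewrite partial_coord eq_sym (negPf ql) mulr0.
rewrite /diamond_coefs UA //.
apply: etrans (diamond_affine e oV oV' Vx phiV sPpsi sTpsi (sc i) (sc j) (sc k) PaE TaE PbE TbE) _.
rewrite -(diamond_coord _ _ _ _ _ _ e) /trivector_apply jac //.
do 3![apply: eq_bigr => ? _]; rewrite !pc.
by rewrite -!mulrA mulrC -!mulrA.
Qed.

Lemma diamond_polydiff (e : nat -> 'I_n) : polydiff_operator diamond_coefs.
Proof.
split=> [P T|]; first exact: diamond_trivector_field.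
exists 3%N, 9%N => a i j k.
have sc l : smooth_on (chart_img a) (coord l : 'rV[R]_n -> R).
  by apply: smooth_coord; apply: open_chart_img.
have [ms [okm E]] := jet_polynomial_diamond e (open_chart_img a) (sc i) (sc j) (sc k).
exists (size ms), (tnth (in_tuple ms)); split=> [t|P T _ _ y _].
  have x0 := tnth (in_tuple ms) t; rewrite (tnth_nth x0).
  by have /(all_nthP x0)/(_ t (ltn_ord t))/asboolP := okm.
by rewrite /diamond_coefs E big_tnth.
Qed.

End charts.

Theorem theorem3 (R : realType) (n : nat) (hn : (2 <= n)%N)
    (N : affine_manifold R n) :
  exists D : bivector_coefs N -> trivector_coefs N -> trivector_coefs N,
  [/\ polydiff_operator D,
      forall (P : bivector_coefs N) (T : trivector_coefs N),
        bivector_field P -> trivector_field T ->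
        forall (W : set N) (f g h : N -> R), open W ->
          smooth_function W f -> smooth_function W g -> smooth_function W h ->
        forall (a : chart N) (x : N), W x -> chart_dom a x ->
          trivector_apply (D P T a)
            (f \o chart_inv a) (g \o chart_inv a) (h \o chart_inv a)
            (chart_map a x)
          = diamond_operator (P a) (T a)
            (f \o chart_inv a) (g \o chart_inv a) (h \o chart_inv a)
            (chart_map a x)
    & forall P : bivector_coefs N, bivector_field P ->
        forall (W : set N) (f g h : N -> R), open W ->
          smooth_function W f -> smooth_function W g -> smooth_function W h ->
        forall (a : chart N) (x : N), W x -> chart_dom a x ->
          schouten (P a) (tetrahedral_flow (P a))
            (f \o chart_inv a) (g \o chart_inv a) (h \o chart_inv a)
            (chart_map a x)
          = trivector_apply (D P (fun b => jacobiator (P b)) a)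
            (f \o chart_inv a) (g \o chart_inv a) (h \o chart_inv a)
            (chart_map a x)].
Proof.
(* Any environment will do, as all indices are summed over; one exists because
   the dimension is positive. *)
pose e : nat -> 'I_n := fun=> Ordinal (ltnW hn).
exists (@diamond_coefs R n N); split; first exact: diamond_polydiff e.
- by move=> P T _ _ W f g h _ _ _ _ a x _ _; apply: diamond_coord e.
move=> P [sP skP _] W f g h oW sf sg sh a x Wx ax.
rewrite [RHS](diamond_coord _ _ _ _ _ _ e).
have oV := @open_chart_image _ _ _ a _ oW.
have Va : chart_map a @` (W `&` chart_dom a) `<=` chart_img a by move=> _ [z [_ az] <-]; exists z.
apply: (schouten_flow e oV _ _ (sf a) (sg a) (sh a)).
- by exists x.
- by move=> i j; apply: smooth_on_sub Va _; apply: sP.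
- by move=> i j y /Va; apply: skP.
Qed.
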